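(* Let $k=k_n$, $m=m_n$ and $\rho=\rho_n\in(0,1)$ depend on $n$, with $n,k,m\to\infty$ and $k=o(n)$. Let $\mathcal{C}$ denote either the class of $k$-sets, the class of $k$-intervals, or the class of disjoint $k$-intervals in $\{1,\dots,n\}$, and suppose that $\rho=o(1/k)$. For the minimax risk $R^*_{\mathbf{AS}}$ of adaptive testing procedures with a budget of $M=mn$ coordinate measurements to converge to zero it is necessary that $\rho k\sqrt{m}\to\infty$.
   Context: Write $[n]=\{1,\dots,n\}$. Model (normalized correlation model). For $S\subseteq[n]$, $\Sigma_S$ is the $n\times n$ matrix with $(\Sigma_S)_{i,i}=1$ for all $i$, $(\Sigma_S)_{i,j}=\rho$ for $i\ne j$ with $i,j\in S$, and $0$ otherwise. The vectors $U^1,U^2,\dots\in\mathbb{R}^n$ are i.i.d. centered Gaussian with covariance $\Sigma_S$. The testing problem is $H_0: S=\emptyset$ versus $H_1: S\in\mathcal{C}$, where $\mathcal{C}$ is a class of subsets of $[n]$ of size $k$. Classes. $k$-sets: all subsets of $[n]$ of cardinality $k$. $k$-intervals: all sets $\{z,z+1,\dots,z+k-1\}$ with $1\le z\le n-k+1$. Disjoint $k$-intervals: the sets $I_j=\{(j-1)k+1,\dots,jk\}$, $j=1,\dots,\lfloor n/k\rfloor$. Adaptive sensing with budget $M$ (a positive integer, $M\ge2$, $m=M/n$). At each round $t=1,\dots,M$ the experimenter chooses a (possibly empty) random query set $A^t\subseteq[n]$, which is a measurable function of the history $H^{t-1}=(A^j,X^j)_{j\le t-1}$ and possibly of additional independent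 randomization, and observes $X^t\in\mathbb{R}^n$ with $X^t_i=U^t_i$ for $i\in A^t$ and $X^t_i=0$ for $i\notin A^t$. The queries must satisfy $\sum_{t=1}^M|A^t|\le M$. The collection $\mathcal{A}$ of conditional distributions of $A^t$ given $H^{t-1}$ is called a sensing strategy; $\mathbf{AS}(M)$ is the set of all of them. A test $\phi$ is a measurable $\{0,1\}$-valued function of $H^M$, and a pair $(\mathcal{A},\phi)$ is an adaptive testing procedure. $\mathbb{P}_S^{\mathcal{A}}$ (resp. $\mathbb{P}_\emptyset^{\mathcal{A}}$) denotes the law of $(A^1,X^1,\dots,A^M,X^M)$ when the contaminated set is $S$ (resp. under $H_0$). The risk is $$R(\mathcal{A},\phi)=\mathbb{P}_\emptyset^{\mathcal{A}}(\phi\ne0)+\max_{S\in\mathcal{C}}\mathbb{P}_S^{\mathcal{A}}(\phi\ne1),$$ and $R^*_{\mathbf{AS}}=\inf_{\mathcal{A}\in\mathbf{AS}(M),\,\phi}R(\mathcal{A},\phi)$. *)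

(* Defs.v *)
From HB Require Import structures.
From mathcomp Require Import all_boot all_order all_algebra.
From mathcomp Require Import all_classical all_reals all_analysis.
From mathcomp Require Import measurable_realfun.

Set Implicit Arguments.
Unset Strict Implicit.
Unset Printing Implicit Defensive.

Import Order.TTheory GRing.Theory Num.Theory.
Import numFieldNormedType.Exports.

Local Open Scope classical_set_scope.
Local Open Scope ring_scope.

Section measurable_finset.
Variable T : finType.

HB.instance Definition _ := isPointed.Build {set T} (@finset.set0 T).

HB.instance Definition _ := @isMeasurable.Build default_measure_display
  {set T} (@discrete_measurable {set T}) (@discrete_measurable0 _)
  (@discrete_measurableC _) (@discrete_measurableU _).

End measurable_finset.

Section tuple_measure.
Context d (T : measurableType d) (R : realType).
Variable m : {sigma_finite_measure set T -> \bar R}.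

Definition tuple_consp n (z : T * n.-tuple T) : n.+1.-tuple T :=
  [tuple of z.1 :: z.2].

Lemma measurable_tuple_consp n : measurable_fun setT (@tuple_consp n).
Proof. exact: (measurable_cons measurable_fst measurable_snd). Qed.

Section step.
Variables (n : nat) (mu : {sigma_finite_measure set (n.-tuple T) -> \bar R}).

Definition cons_measure : set (n.+1.-tuple T) -> \bar R :=
  pushforward (m \x mu)%E (@tuple_consp n).

Let m0 : cons_measure set0 = 0%E.
Proof. by rewrite /cons_measure /pushforward preimage_set0 measure0. Qed.

Let m_ge0 A : (0 <= cons_measure A)%E.
Proof. by rewrite /cons_measure /pushforward; exact: measure_ge0. Qed.

Let m_additive : semi_sigma_additive cons_measure.
Proof.
move=> F mF tF mUF; rewrite /cons_measure /pushforward preimage_bigcup.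
have mpre A : measurable A -> measurable (@tuple_consp n @^-1` A).
  by move=> mA; rewrite -[X in measurable X]setTI; exact: measurable_tuple_consp.
apply: measure_semi_sigma_additive.
- by move=> i; exact: mpre.
- apply/trivIsetP => /= i j _ _ ij; rewrite -preimage_setI.
  by move/trivIsetP : tF => /(_ i j Logic.I Logic.I ij) ->; rewrite preimage_set0.
- by rewrite -preimage_bigcup; exact: mpre.
Qed.

HB.instance Definition _ :=
  isMeasure.Build _ _ _ cons_measure m0 m_ge0 m_additive.

Let m_sigma_finite : sigma_finite setT cons_measure.
Proof.
have /sigma_finiteP[F [FT Fnd Foo]] := sigma_finiteT m.
have /sigma_finiteP[G [GT Gnd Goo]] := sigma_finiteT mu.
pose g (x : n.+1.-tuple T) : T * n.-tuple T := (thead x, [tuple of behead x]).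
have gK z : g (tuple_consp z) = z.
  by case: z => x v; congr pair => //; apply/val_inj.
have mg : measurable_fun setT g.
  apply/measurable_fun_pairP; split; first exact: (measurable_tnth ord0).
  exact: measurable_behead.
exists (fun i => g @^-1` (F i `*` G i)).
  rewrite -preimage_bigcup (_ : \bigcup_i (F i `*` G i) = setT) ?preimage_setT//.
  apply/seteqP; split => // -[x v] _.
  have [i _ Fx] : (\bigcup_i F i) x by rewrite -FT.
  have [j _ Gv] : (\bigcup_i G i) v by rewrite -GT.
  exists (maxn i j) => //; split.
    by move: x Fx; exact/subsetPset/Fnd/leq_maxl.
  by move: v Gv; exact/subsetPset/Gnd/leq_maxr.
move=> i; have [mF Fi] := Foo i; have [mG Gi] := Goo i; split.
  by rewrite -[X in measurable X]setTI; apply: mg => //; exact: measurableX.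
rewrite /cons_measure /pushforward -comp_preimage.
rewrite (_ : g \o @tuple_consp n = id) ?preimage_id; last exact/funext.
by rewrite product_measure1E// lte_mul_pinfty// ge0_fin_numE.
Qed.

HB.instance Definition _ :=
  Measure_isSigmaFinite.Build _ _ _ cons_measure m_sigma_finite.

End step.

Fixpoint tuple_measure n : {sigma_finite_measure set (n.-tuple T) -> \bar R} :=
  match n with
  | 0 => \d_([tuple] : 0.-tuple T)
  | n'.+1 => cons_measure (tuple_measure n')
  end.

End tuple_measure.

(* measurableTypeR R is the copy of R on which lebesgue_measure is defined. *)
Notation vec R n := (n.-tuple (measurableTypeR R)).

Definition lebesgue_vec (R : realType) (n : nat)
    : {sigma_finite_measure set (vec R n) -> \bar R} :=
  tuple_measure (@lebesgue_measure R) n.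

Section gaussian.
Variables (R : realType) (n : nat).

Definition vec_col (x : vec R n) : 'cV[R]_n := \col_i (tnth x i : R).

Definition gaussian_fun (Sigma : 'M[R]_n) (x : vec R n) : R :=
  expR (- ((vec_col x)^T *m invmx Sigma *m vec_col x) 0 0 / 2).

Lemma measurable_gaussian_fun Sigma : measurable_fun setT (gaussian_fun Sigma).
Proof.
apply: measurableT_comp => //; apply: measurable_funM => //.
apply: measurableT_comp => //.
under eq_fun do (rewrite mxE; under eq_bigr do rewrite mxE big_distrl/=).
apply: measurable_sum => i; apply: measurable_sum => j.
under eq_fun do rewrite !mxE.
apply: measurable_funM; last exact: measurable_tnth.
by apply: measurable_funM => //; exact: measurable_tnth.
Qed.

Definition gaussian_weight (Sigma : 'M[R]_n) (B : set (vec R n)) : \bar R :=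
  (\int[lebesgue_vec R n]_(x in B) (gaussian_fun Sigma x)%:E)%E.

Section weight.
Variable Sigma : 'M[R]_n.

Let w0 : gaussian_weight Sigma set0 = 0%E.
Proof. exact: integral_set0. Qed.

Let w_ge0 B : (0 <= gaussian_weight Sigma B)%E.
Proof. by apply: integral_ge0 => x _; rewrite lee_fin expR_ge0. Qed.

Let w_additive : semi_sigma_additive (gaussian_weight Sigma).
Proof.
apply: (semi_sigma_additive_nng_induced
  (f := fun x => (gaussian_fun Sigma x)%:E)).
  by apply/measurable_EFinP; exact: measurable_gaussian_fun.
by move=> x; rewrite lee_fin expR_ge0.
Qed.

HB.instance Definition _ :=
  isMeasure.Build _ _ _ (gaussian_weight Sigma) w0 w_ge0 w_additive.

End weight.

(* The centered Gaussian law N(0, Sigma), for Sigma symmetric positive definite: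
   the probability measure whose Lebesgue density is proportional to
   exp (- x^T Sigma^-1 x / 2).  The Dirac mass is the value that mnormalize takes
   when the total weight is 0 or +oo; for Sigma positive definite that weight is
   sqrt ((2 pi)^n det Sigma), so this case does not occur. *)
Definition gaussian (Sigma : 'M[R]_n) : probability (vec R n) R :=
  mnormalize (gaussian_weight Sigma) \d_([tuple of nseq n 0] : vec R n).

(* correlation_mx rho S is positive definite for every S when 0 < rho < 1. *)
Definition correlation_mx (rho : R) (S : {set 'I_n}) : 'M[R]_n :=
  \matrix_(i, j) if i == j then 1
                 else if (i \in S) && (j \in S) then rho else 0.

End gaussian.

Section adaptive_sensing.
Variables (R : realType) (n : nat).

Definition observation : Type := ({set 'I_n} * vec R n)%type.

HB.instance Definition _ := Measurable.on observation.

(* The pairs (A^j, X^j) of the first t rounds, most recent round first. *)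
Definition history (t : nat) : Type := t.-tuple observation.

HB.instance Definition _ t := Measurable.on (history t).

Definition mask (A : {set 'I_n}) (u : vec R n) : vec R n :=
  [tuple if i \in A then (tnth u i : R) else 0 | i < n].

Definition record_round t (h : history t) (A : {set 'I_n}) (u : vec R n)
  : history t.+1 := [tuple of (A, mask A u) :: h].

(* The conditional laws of the query of each round given the previous rounds:
   the kernel of index t governs round t + 1. *)
Definition strategy : Type :=
  forall t : nat, R.-pker (history t) ~> {set 'I_n}.

Section next_round.
Variables (t : nat) (P : probability (history t) R).
Variables (q : R.-pker (history t) ~> {set 'I_n}).
Variable (N : probability (vec R n) R).

(* Law of the history after one more round: the past h has law P, the query A
   has law q h given h, and the fresh vector u has law N independently of
   (h, A). *)
Definition next_law (B : set (history t.+1)) : \bar R :=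
  (\int[P]_h \int[q h]_A N [set u | B (record_round h A u)])%E.

Let next0 : next_law set0 = 0%E.
Proof.
rewrite /next_law; apply: integral0_eq => h _; apply: integral0_eq => A _.
by rewrite measure0.
Qed.

Let next_ge0 B : (0 <= next_law B)%E.
Proof. by apply: integral_ge0 => h _; exact: integral_ge0. Qed.

Let measurable_record : measurable_fun setT
  (fun z : (history t * {set 'I_n}) * vec R n =>
     record_round z.1.1 z.1.2 z.2).
Proof.
apply: measurable_cons; last exact: measurableT_comp.
apply/measurable_fun_pairP; split.
  exact: (measurableT_comp measurable_snd measurable_fst).
apply/measurable_fun_tnthP => i /=.
rewrite (_ : _ \o _ = fun z : (history t * {set 'I_n}) * vec R n =>
  if (fun A : {set 'I_n} => i \in A) z.1.2 then (tnth z.2 i : R) else 0).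
  apply: measurable_fun_ifT => //.
    apply: (@measurableT_comp _ _ _ _ _ _ (fun A : {set 'I_n} => i \in A)) => //.
    exact: measurableT_comp.
  exact: (measurableT_comp (measurable_tnth i) measurable_snd).
by apply/funext => z /=; rewrite tnth_mktuple.
Qed.

Let inner (B : set (history t.+1)) (z : history t * {set 'I_n}) : \bar R :=
  N [set u | B (record_round z.1 z.2 u)].

Let measurable_inner B : measurable B -> measurable_fun setT (inner B).
Proof.
move=> mB.
pose C := (fun z : (history t * {set 'I_n}) * vec R n =>
     record_round z.1.1 z.1.2 z.2) @^-1` B.
have mC : measurable C.
  by rewrite -[X in measurable X]setTI; exact: measurable_record.
rewrite (_ : inner B = N \o xsection C); first exact: measurable_fun_xsection.
by apply/funext => z; rewrite /inner /= xsectionE.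
Qed.

Let measurable_outer B : measurable B ->
  measurable_fun setT (fun h => \int[q h]_A inner B (h, A))%E.
Proof.
move=> mB; apply: (measurable_kfcomp q (f := inner B)) => //.
exact: measurable_inner.
Qed.

Let next_additive : semi_sigma_additive next_law.
Proof.
move=> F mF tF mUF.
have -> : next_law (\bigcup_i F i) = (\sum_(0 <= i <oo) next_law (F i))%E.
  rewrite /next_law -integral_nneseries//=; last 2 first.
  - by move=> i; exact: measurable_outer.
  - by move=> i h _; exact: integral_ge0.
  apply: eq_integral => h _; rewrite -integral_nneseries//=.
  apply: eq_integral => A _.
  rewrite (_ : [set u | _] = \bigcup_i [set u | F i (record_round h A u)])//.
  have mS B : measurable B -> measurable [set u | B (record_round h A u)].
    move=> mB; rewrite -[X in measurable X]setTI.
    by apply: (measurableT_comp measurable_record (pair1_measurable (h, A))).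
  rewrite measure_semi_bigcup//.
  - by move=> i; exact: mS.
  - apply/trivIsetP => i j _ _ ij.
    move/trivIsetP : tF => /(_ i j Logic.I Logic.I ij) FF.
    rewrite -subset0 => u [/= Fi Fj].
    by have : (F i `&` F j) (record_round h A u) by []; rewrite FF.
  - exact: (mS (\bigcup_i F i)).
by apply: is_cvg_ereal_nneg_natsum_cond => i _ _; exact: next_ge0.
Qed.

HB.instance Definition _ :=
  isMeasure.Build _ _ _ next_law next0 next_ge0 next_additive.

Let next_setT : next_law setT = 1%E.
Proof.
rewrite /next_law -[RHS](probability_setT P) -[RHS]mul1e.
rewrite -integral_cst//; apply: eq_integral => h _.
transitivity (\int[q h]_A cst 1 A)%E.
  by apply: eq_integral => A _; exact: probability_setT.
by rewrite integral_cst// mul1e; exact: prob_kernel.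
Qed.

HB.instance Definition _ :=
  Measure_isProbability.Build _ _ _ next_law next_setT.

End next_round.

(* Law of the first t rounds when the contaminated set is S. *)
Fixpoint history_law (rho : R) (S : {set 'I_n}) (A : strategy) (t : nat)
    : probability (history t) R :=
  match t with
  | 0 => \d_([tuple] : history 0)
  | t'.+1 => next_law (history_law rho S A t') (A t')
               (gaussian (correlation_mx rho S))
  end.

Definition queries t (h : history t) : nat := (\sum_(o <- h) #|o.1|)%N.

(* The strategies with budget M: the budget is respected almost surely.  For
   0 < rho < 1 the laws of the history under the various rho and S have the same
   null sets, so that this does not depend on the choice of rho and S. *)
Definition AS (M : nat) : set strategy :=
  [set A | forall (rho : R) (S : {set 'I_n}), 0 < rho < 1 ->
     history_law rho S A M [set h | (queries h <= M)%N] = 1%E].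

(* {mfun history M >-> bool} is the type of tests: true rejects H_0. *)
Definition risk (rho : R) (C : {set {set 'I_n}}) (M : nat) (A : strategy)
    (phi : {mfun history M >-> bool}) : \bar R :=
  (history_law rho (@finset.set0 _) A M [set h | phi h != false]
   + \big[maxe/0]_(S in C) history_law rho S A M [set h | phi h != true])%E.

Definition minimax_risk (rho : R) (C : {set {set 'I_n}}) (M : nat) : \bar R :=
  ereal_inf [set r | exists A : strategy, AS M A /\
                     exists phi : {mfun history M >-> bool},
                       r = risk rho C A phi].

End adaptive_sensing.

Section classes.
Local Open Scope nat_scope.
Variables (n k : nat).

(* {z, ..., z + k - 1}, indices being counted from 0 *)
Definition interval_set (z : nat) : {set 'I_n} :=
  [set i : 'I_n | z <= i < z + k]%SET.

Definition k_sets : {set {set 'I_n}} := [set S : {set 'I_n} | #|S| == k]%SET.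

Definition k_intervals : {set {set 'I_n}} :=
  [set interval_set z | z : 'I_n & z + k <= n]%SET.

Definition disjoint_k_intervals : {set {set 'I_n}} :=
  [set interval_set (j * k) | j : 'I_(n %/ k)]%SET.

End classes.

Variant class_kind := KSets | KIntervals | DisjointKIntervals.

Definition class_of (c : class_kind) (n k : nat) : {set {set 'I_n}} :=
  match c with
  | KSets => k_sets n k
  | KIntervals => k_intervals n k
  | DisjointKIntervals => disjoint_k_intervals n k
  end.

(* Main.v *)
Require Import Defs.
From HB Require Import structures.
From mathcomp Require Import all_boot all_order all_algebra.
From mathcomp Require Import all_classical all_reals all_analysis.
From mathcomp Require Import measurable_realfun.
From mathcomp Require Import zify ring lra.

Set Implicit Arguments.
Unset Strict Implicit.
Unset Printing Implicit Defensive.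

Import Order.TTheory GRing.Theory Num.Theory.
Import numFieldNormedType.Exports.

Local Open Scope classical_set_scope.
Local Open Scope ring_scope.

(** A strategy with small risk tells the null law of the history from its law
    under every contaminated set S of the class, and a single well chosen S
    already forbids this when rho k sqrt m stays bounded.

    A query A reveals only the coordinates in A, and the restriction of the
    correlated Gaussian vector to A is again such a vector, with contaminated
    set the intersection of S and A.  With r = rho / (1 - rho) and s the size of
    that intersection, the likelihood ratio of an observation x is at least
      exp (b_s (sum x_i)^2 / 2 - r (sum x_i^2) / 2),
      b_s = r (1 + r) / (1 + s r),
    with sums over the intersection; the discarded normalizing factor is the
    inverse square root of a determinant that is at most 1.  Under the null
    the exponent has expectation s (b_s - r) / 2 >= - r^2 s^2 / 2: the terms of
    first order in rho cancel.  Given the past, the log-likelihood ratio of a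
    whole history (history_law_dominates) thus loses at most r^2 |S| / 2 times
    the overlap of the next query with S (integral_score_sq_le).

    If the expected total loss is at most C, then the likelihood ratio exceeds
    exp (- 2 (C + 1)) with null probability at least one half, which bounds the
    sum of the two error probabilities from below (two_point_bound).

    The set S is found by pigeonhole: the disjoint k-intervals lie in all three
    classes, there are at least n / (2 k) of them, and at most M coordinates are
    measured, so that under the null one of them meets the queries in at most
    2 k M / n coordinates on average (exists_block_small_overlap).  As r <= 2 rho
    once rho <= 1/2, its loss is at most 4 rho^2 k^2 m (minimax_risk_ge).  So a
    bound on rho k sqrt m along infinitely many n keeps the minimax risk away
    from zero along them. *)

(** * Positive functionals and uniqueness of the representing measure *)

Section daniell.
Local Open Scope ereal_scope.
Context {R : realType}.

(** The properties of integration against a measure, stated for a functional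
    so that iterated integrals are obtained by composition, without building
    the measure that they define. *)
Variant daniell d (T : measurableType d) (I : (T -> \bar R) -> \bar R) : Prop :=
  Daniell of
    (forall f, measurable_fun setT f -> (forall x, 0 <= f x) -> 0 <= I f) &
    (forall f g, measurable_fun setT f -> (forall x, 0 <= f x) ->
       measurable_fun setT g -> (forall x, f x <= g x) -> I f <= I g) &
    (forall f g, measurable_fun setT f -> (forall x, 0 <= f x) ->
       measurable_fun setT g -> (forall x, 0 <= g x) ->
       I (fun x => f x + g x) = I f + I g) &
    (forall (c : R) f, (0 <= c)%R -> measurable_fun setT f ->
       (forall x, 0 <= f x) -> I (fun x => c%:E * f x) = c%:E * I f) &
    (forall f : (T -> \bar R)^nat, (forall i, measurable_fun setT (f i)) ->
       (forall i x, 0 <= f i x) -> (forall x, nondecreasing_seq (f^~ x)) ->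
       I (fun x => limn (f^~ x)) = limn (fun i => I (f i))).

Lemma daniell_weighted_eval d d' (T : measurableType d) (U : measurableType d')
    (phi : U -> T) (u : U) (c : R) :
  (0 <= c)%R -> daniell (fun f : T -> \bar R => f (phi u) * c%:E).
Proof.
move=> c0; have c0' : 0 <= c%:E by rewrite lee_fin.
split.
- by move=> f _ f0; rewrite mule_ge0.
- by move=> f g _ f0 _ fg; rewrite lee_wpmul2r.
- by move=> f g _ f0 _ g0; rewrite ge0_muleDl.
- by move=> k f k0 _ f0; rewrite muleA.
- move=> f _ f0 ndf; rewrite -limeMr//.
  exact: (ereal_nondecreasing_is_cvgn (ndf (phi u))).
Qed.

Lemma daniell_eval d d' (T : measurableType d) (U : measurableType d')
    (phi : U -> T) (u : U) : daniell (fun f : T -> \bar R => f (phi u)).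
Proof.
have -> : (fun f : T -> \bar R => f (phi u)) = (fun f => f (phi u) * 1%:E).
  by apply/funext => f; rewrite mule1.
exact: daniell_weighted_eval.
Qed.

Lemma daniell_integral d d' (T : measurableType d) (X : measurableType d')
    (mu : {measure set X -> \bar R}) (J : X -> (T -> \bar R) -> \bar R) :
  (forall x, daniell (J x)) ->
  (forall f, measurable_fun setT f -> (forall x, 0 <= f x) ->
     measurable_fun setT (fun x => J x f)) ->
  daniell (fun f => \int[mu]_x J x f).
Proof.
move=> dJ mJ.
have J0 x f : measurable_fun setT f -> (forall t, 0 <= f t) -> 0 <= J x f.
  by case: (dJ x) => + _ _ _ _; exact.
split.
- by move=> f mf f0; apply: integral_ge0 => x _; exact: J0.
- move=> f g mf f0 mg fg.
  have g0 t : 0 <= g t by exact: le_trans (f0 t) (fg t).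
  apply: ge0_le_integral => //; [by move=> x _; exact: J0|exact: mJ|exact: mJ|].
  by move=> x _; case: (dJ x) => _ + _ _ _; exact.
- move=> f g mf f0 mg g0; rewrite -ge0_integralD//; last 4 first.
  + by move=> x _; exact: J0.
  + exact: mJ.
  + by move=> x _; exact: J0.
  + exact: mJ.
  by apply: eq_integral => x _; case: (dJ x) => _ _ + _ _; exact.
- move=> c f c0 mf f0; rewrite -ge0_integralZl_EFin//; last 2 first.
  + by move=> x _; exact: J0.
  + exact: mJ.
  by apply: eq_integral => x _; case: (dJ x) => _ _ _ + _; exact.
- move=> f mf f0 ndf; rewrite -monotone_convergence//.
  + by apply: eq_integral => x _; case: (dJ x) => _ _ _ _; exact.
  + by move=> i; exact: mJ.
  + by move=> i x _; exact: J0.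
  + move=> x _ i j ij; case: (dJ x) => _ + _ _ _; apply => //.
    by move=> t; exact: ndf.
Qed.

Import HBNNSimple.

(** A functional with these properties is determined by its values on
    indicators, by approximation with nonnegative simple functions.  This is how
    integrals against the Gaussian law and against the law of one more round,
    both of which are known through the measure of sets, get computed. *)
Lemma daniell_measure_unique d (T : measurableType d)
    (mu : {measure set T -> \bar R}) (I : (T -> \bar R) -> \bar R) :
  daniell I -> (forall B, measurable B -> I (fun x => (\1_B x)%:E) = mu B) ->
  forall f, measurable_fun setT f -> (forall x, 0 <= f x) ->
  \int[mu]_x f x = I f.
Proof.
move=> [_ _ ID IZ Ilim] Imu f mf f0.
have Isum (s : seq R) (B : R -> set T) : (forall c, c \in s -> 0 <= c)%R ->
    (forall c, measurable (B c)) ->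
    I (fun x => \sum_(c <- s) c%:E * (\1_(B c) x)%:E) = \sum_(c <- s) c%:E * mu (B c).
  move=> + mB; elim: s => [_|c s ih cs0].
    under eq_fun do rewrite big_nil.
    have /= := IZ 0%R (cst 0) (lexx _) (measurable_cst _) (fun=> lexx _).
    by under eq_fun do rewrite mul0e; rewrite mul0e big_nil.
  under eq_fun do rewrite big_cons.
  have c0 : (0 <= c)%R by apply: cs0; rewrite mem_head.
  have s0 e : e \in s -> (0 <= e)%R by move=> es; apply: cs0; rewrite inE es orbT.
  have mi e : measurable_fun setT (fun x => (\1_(B e) x)%:E : \bar R).
    by apply/measurable_EFinP; exact: measurable_indic.
  rewrite ID.
  - by rewrite IZ// ?Imu// ih// big_cons.
  - by apply: emeasurable_funM.
  - by move=> x; rewrite mule_ge0.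
  - by apply: emeasurable_sum => e; apply: emeasurable_funM.
  - by move=> x; rewrite big_seq sume_ge0// => e /s0 e0; rewrite mule_ge0.
have Insf (g : {nnsfun T >-> R}) : I (fun x => (g x)%:E) = \int[mu]_x (g x)%:E.
  pose s := finmap.enum_fset (fset_set (range g)).
  have s0 c : c \in s -> (0 <= c)%R.
    by rewrite [_ \in _](in_fset_set (fimfunP g)) inE => -[x _ <-].
  have gE : (fun x => (g x)%:E) =
      (fun x => \sum_(c <- s) c%:E * (\1_(g @^-1` [set c]) x)%:E).
    apply/funext => x; rewrite [in LHS](fimfunE g) fsbig_finite//=.
    by rewrite -sumEFin; apply: eq_bigr => c _; rewrite EFinM.
  rewrite gE Isum// big_seq [in RHS](eq_integral (fun x =>
    \sum_(c <- s) (if c \in s then c%:E * (\1_(g @^-1` [set c]) x)%:E else 0))).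
    rewrite ge0_integral_sum//.
    - rewrite [in RHS]big_seq; apply: eq_bigr => c cs.
      have c0 := s0 _ cs.
      rewrite cs ge0_integralZl_EFin//.
        by rewrite (@integral_indic _ _ _ mu setT measurableT)// setIT.
      exact/measurable_EFinP/measurable_indic.
    - move=> c; case: (c \in s) => //; apply: emeasurable_funM => //.
      exact/measurable_EFinP/measurable_indic.
    - move=> c x _; case: ifPn => // cs; rewrite mule_ge0//lee_fin; exact: s0.
  by move=> x _; rewrite !big_seq; apply: eq_bigr => c ->.
pose f_ := nnsfun_approx measurableT mf.
have fE : f = (fun x => limn (fun i => (f_ i x)%:E)).
  by apply/funext => x; apply/esym/cvg_lim => //; exact: cvg_nnsfun_approx.
rewrite [in RHS]fE Ilim.
- rewrite [in LHS]fE monotone_convergence//.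
  + by under eq_fun do rewrite -Insf.
  + by move=> i; exact/measurable_EFinP.
  + by move=> i x _; rewrite lee_fin.
  + by move=> x _ a b ab; rewrite lee_fin; exact/lefP/nd_nnsfun_approx.
- by move=> i; exact/measurable_EFinP.
- by move=> i x; rewrite lee_fin.
- by move=> x a b ab; rewrite lee_fin; exact/lefP/nd_nnsfun_approx.
Qed.

End daniell.
(** * Second moments of the standard normal law *)
Section normal_moment.
Context {R : realType}.
Local Notation mu := (@lebesgue_measure R).
Local Notation phi := (normal_pdf (0 : R) 1).

Lemma normal_pdf_scale (t x : R) : 0 < t ->
  t * normal_pdf 0 t x = phi x * expR ((1 - t ^- 2) / 2 * x ^+ 2).
Proof.
move=> t0; rewrite !normal_pdfE ?gt_eqF//= /normal_peak /normal_fun.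
rewrite -mulrnAr sqrtrM ?sqr_ge0// sqrtr_sqr ger0_norm ?ltW// invfM -[in LHS]mulrA.
rewrite mulVKf ?gt_eqF// expr1n mul1r -[RHS]mulrA -expRD.
rewrite !subr0.
have -> : - x ^+ 2 / (t ^+ 2 *+ 2) =
    - x ^+ 2 / (1 *+ 2) + (1 - t ^- 2) / 2 * x ^+ 2.
  by field; rewrite gt_eqF.
by [].
Qed.

Let mphi : measurable_fun setT (fun x => (phi x)%:E : \bar R).
Proof. by apply/measurable_EFinP; exact: measurable_normal_pdf. Qed.

Let mphisq (a : R) : measurable_fun setT (fun x => (phi x * (a + x) ^+ 2)%:E : \bar R).
Proof.
apply/measurable_EFinP; apply: measurable_funM; first exact: measurable_normal_pdf.
by apply: measurable_funX; exact: measurable_funD.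
Qed.

Let mphisq0 : measurable_fun setT (fun x => (phi x * x ^+ 2)%:E : \bar R).
Proof. by move: (mphisq 0); under eq_fun do rewrite add0r. Qed.

Let phisq_ge0 (a x : R) : 0 <= phi x * (a + x) ^+ 2.
Proof. by rewrite mulr_ge0 ?normal_pdf_ge0 ?sqr_ge0. Qed.

Let phisq0_ge0 (x : R) : 0 <= phi x * x ^+ 2.
Proof. by rewrite mulr_ge0 ?normal_pdf_ge0 ?sqr_ge0. Qed.

Let M2 := (\int[mu]_x (phi x * x ^+ 2)%:E)%E.

Let integral_scaled (t : R) : 0 < t ->
  (\int[mu]_x (t * normal_pdf 0 t x)%:E = t%:E)%E.
Proof.
move=> t0; under eq_integral do rewrite EFinM.
rewrite ge0_integralZl_EFin//.
- by rewrite integral_normal_pdf mule1.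
- by move=> x _; rewrite lee_fin normal_pdf_ge0.
- by apply/measurable_EFinP; exact: measurable_normal_pdf.
- exact: ltW.
Qed.

Let mscaled (t : R) : measurable_fun setT (fun x => (t * normal_pdf 0 t x)%:E : \bar R).
Proof.
by apply/measurable_EFinP; apply: measurable_funM => //; exact: measurable_normal_pdf.
Qed.

Let integralZM2 (c : R) : 0 <= c ->
  (\int[mu]_x (c * (phi x * x ^+ 2))%:E = c%:E * M2)%E.
Proof.
move=> c0; under eq_integral do rewrite EFinM.
by rewrite ge0_integralZl_EFin// => x _; rewrite lee_fin.
Qed.

Let mZ (c : R) : measurable_fun setT (fun x => (c * (phi x * x ^+ 2))%:E : \bar R).
Proof.
apply/measurable_EFinP; apply: measurable_funM => //.
apply: measurable_funM; first exact: measurable_normal_pdf.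
exact: measurable_funX.
Qed.

(* expR y >= 1 + y bounds the rescaled density below by the standard density
   times a polynomial of degree two; total masses are then compared. *)
Let M2_upper (t : R) : 1 < t -> (1 + ((1 - t ^- 2) / 2)%:E * M2 <= t%:E)%E.
Proof.
move=> t1; have t0 : 0 < t by exact: lt_trans t1.
have u0 : 0 <= (1 - t ^- 2) / 2.
  by rewrite divr_ge0// subr_ge0 invf_le1 ?exprn_gt0// exprn_ege1// ltW.
rewrite -(integral_scaled t0) -(integral_normal_pdf 0 (1:R)) -integralZM2//.
rewrite -ge0_integralD//; last 3 first.
  by move=> x _; rewrite lee_fin normal_pdf_ge0.
  by move=> x _; rewrite lee_fin mulr_ge0.
  exact: mZ.
apply: ge0_le_integral => //.
- by move=> x _; rewrite -EFinD lee_fin addr_ge0 ?normal_pdf_ge0// mulr_ge0.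
- by apply: emeasurable_funD; [exact: mphi|exact: mZ].
- exact: mscaled.
- move=> x _; rewrite -EFinD lee_fin normal_pdf_scale//.
  rewrite mulrCA -[X in X + _]mulr1 -mulrDr ler_wpM2l ?normal_pdf_ge0//.
  exact: expR_ge1Dx.
Qed.

Let M2_lower (t : R) : 0 < t -> t < 1 -> (1 <= t%:E + ((t ^- 2 - 1) / 2)%:E * M2)%E.
Proof.
move=> t0 t1.
have u0 : 0 <= (t ^- 2 - 1) / 2.
  by rewrite divr_ge0// subr_ge0 invf_ge1 ?exprn_gt0// exprn_ile1// ltW.
rewrite -[X in (_ <= X + _)%E](integral_scaled t0) -(integral_normal_pdf 0 (1:R)).
rewrite -integralZM2// -ge0_integralD//; last 4 first.
  by move=> x _; rewrite lee_fin mulr_ge0 ?normal_pdf_ge0// ltW.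
  exact: mscaled.
  by move=> x _; rewrite lee_fin mulr_ge0.
  exact: mZ.
apply: ge0_le_integral => //.
- by move=> x _; rewrite lee_fin normal_pdf_ge0.
- by apply: emeasurable_funD; [exact: mscaled|exact: mZ].
- move=> x _; rewrite -EFinD lee_fin normal_pdf_scale//.
  rewrite [X in _ + X]mulrCA -mulrDr -[leLHS]mulr1 ler_wpM2l ?normal_pdf_ge0//.
  rewrite -lerBlDr (le_trans _ (expR_ge1Dx _))//.
  by rewrite -mulNr -mulNr opprB.
Qed.

(** The bounds above hold for all scales t on either side of 1, and letting t tend
    to 1 squeezes the second moment. *)
Lemma integral_normal_sqr : (\int[mu]_x (phi x * x ^+ 2)%:E = 1)%E.
Proof.
rewrite -/M2.
have M0 : (0 <= M2)%E by apply: integral_ge0 => x _; rewrite lee_fin.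
have Mfin : M2 \is a fin_num.
  have := @M2_upper 2; rewrite ltr1n => /(_ isT).
  case: M2 M0 => [//|_|//]; rewrite gt0_muley//.
  by rewrite lte_fin; lra.
have [m m0 mE] : exists2 m : R, 0 <= m & M2 = m%:E.
  by exists (fine M2); rewrite ?fineK// fine_ge0.
have up := M2_upper; have lo := M2_lower.
rewrite mE in up lo *; clear M0 Mfin mE; congr EFin; apply/eqP; rewrite eq_le.
apply/andP; split.
  rewrite leNgt; apply/negP => m1.
  (* At t = 1 + d the bound reads m (2 + d) <= 2 (1 + d)^2, whose right-hand side
     is at most (2 + d) (1 + 2 d): it excludes d <= (m - 1) / 4. *)
  pose d := Num.min 1 ((m - 1) / 4).
  have d0 : 0 < d by rewrite /d lt_min ltr01/= divr_gt0// subr_gt0.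
  have d1 : d <= 1 by rewrite /d ge_min lexx.
  have dm : d <= (m - 1) / 4 by rewrite /d ge_min lexx orbT.
  have /up : 1 < 1 + d by rewrite ltrDl.
  rewrite -EFinM -EFinD lee_fin.
  have -> : 1 - (1 + d) ^- 2 = d * (2 + d) / (1 + d) ^+ 2.
    by field; rewrite gt_eqF// addr_gt0.
  rewrite lerD2l -!mulrA -[leRHS]mulr1 ler_pM2l//.
  rewrite mulrA (mulrC _^-1) mulrA ler_pdivrMr// mul1r mulrAC.
  rewrite ler_pdivrMr ?exprn_gt0 ?addr_gt0// => h.
  have  : 0 <= (2 + d) * (m - 1 - 4 * d).
    by rewrite mulr_ge0; lra.
  nra.
rewrite leNgt; apply/negP => m1.
pose d := (1 - m) / 4.
have d0 : 0 < d by rewrite /d divr_gt0// subr_gt0.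
have d1 : d <= 1 / 4 by rewrite /d ler_pM2r//; lra.
have t0 : 0 < 1 - d by lra.
have /(lo _ t0) : 1 - d < 1 by lra.
rewrite -EFinM -EFinD lee_fin.
have -> : (1 - d) ^- 2 - 1 = d * (2 - d) / (1 - d) ^+ 2.
  by field; rewrite gt_eqF.
have -> : d * (2 - d) / (1 - d) ^+ 2 / 2 * m = d * ((2 - d) * m / ((1 - d) ^+ 2 * 2)).
  by field; rewrite gt_eqF.
rewrite -[X in X <= _](subrK d) lerD2l -[X in X <= _]mulr1 ler_pM2l//.
rewrite ler_pdivlMr ?mulr_gt0 ?exprn_gt0// mul1r.
have -> : m = 1 - 4 * d by rewrite /d; field.
nra.
Qed.

(** The cross term disappears on averaging with the reflected integral. *)
Lemma integral_normal_sqrD (a : R) :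
  (\int[mu]_x (phi x * (a + x) ^+ 2)%:E = (a ^+ 2 + 1)%:E)%E.
Proof.
set I := (\int[mu]_x _)%E.
have I0 : (0 <= I)%E by apply: integral_ge0 => x _; rewrite lee_fin.
have phiN x : phi (- x) = phi x.
  by rewrite !normal_pdfE ?oner_neq0//= /normal_fun !subr0 sqrrN.
have IN : I = (\int[mu]_x (phi x * (a - x) ^+ 2)%:E)%E.
  have mN : measurable_fun setT (-%R : measurableTypeR R -> measurableTypeR R).
    exact: measurable_funN.
  transitivity (\int[pushforward mu (-%R : _ -> measurableTypeR R)]_x
     (phi x * (a + x) ^+ 2)%:E)%E.
    by apply: eq_measure_integral => A mA _; exact/esym/lebesgue_measureN.
  rewrite ge0_integral_pushforward//=.
  - by apply: eq_integral => x _ /=; rewrite phiN.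
  - exact: mphisq.
  - by move=> x _; rewrite lee_fin.
have : (I + I = (2 * (a ^+ 2 + 1))%:E)%E.
  rewrite {2}IN -ge0_integralD//; last 4 first.
  - by move=> x _; rewrite lee_fin.
  - exact: mphisq.
  - by move=> x _; rewrite lee_fin mulr_ge0 ?normal_pdf_ge0 ?sqr_ge0.
  - apply/measurable_EFinP; apply: measurable_funM; first exact: measurable_normal_pdf.
    by apply: measurable_funX; exact: measurable_funB.
  transitivity (\int[mu]_x ((2 * a ^+ 2)%:E * (phi x)%:E + 2%:E * (phi x * x ^+ 2)%:E))%E.
    by apply: eq_integral => x _; rewrite -!EFinM -!EFinD; congr EFin; ring.
  rewrite ge0_integralD//; last 4 first.
  - by move=> x _; rewrite -EFinM lee_fin mulr_ge0 ?normal_pdf_ge0// mulr_ge0 ?sqr_ge0.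
  - by apply: emeasurable_funM => //; exact: mphi.
  - by move=> x _; rewrite -EFinM lee_fin mulr_ge0.
  - by apply: emeasurable_funM => //; exact: mphisq0.
  rewrite !ge0_integralZl_EFin//; last 3 first.
  - by move=> x _; rewrite lee_fin.
  - by move=> x _; rewrite lee_fin normal_pdf_ge0.
  - by rewrite mulr_ge0 ?sqr_ge0.
  rewrite integral_normal_sqr integral_normal_pdf !mule1 -EFinD.
  by congr EFin; ring.
case: I I0 {IN} => [r _|//|//]; rewrite -EFinD => -[rr].
by congr EFin; lra.
Qed.

End normal_moment.
(** * Product densities on vectors *)
Section product_density.
Local Open Scope ereal_scope.
Context {R : realType}.
Local Notation mu := (@lebesgue_measure R).

Definition pdf (g : measurableTypeR R -> R) : Prop :=
  [/\ measurable_fun setT g, forall x, (0 <= g x)%R & \int[mu]_x (g x)%:E = 1].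

Lemma pdf_normal (m s : R) : pdf (normal_pdf m s).
Proof.
by split; [exact: measurable_normal_pdf|exact: normal_pdf_ge0|exact: integral_normal_pdf].
Qed.

Definition prod_pdf n (g : 'I_n -> measurableTypeR R -> R) (x : vec R n) : R :=
  (\prod_(i < n) g i (tnth x i))%R.

Lemma prod_pdf_ge0 n (g : 'I_n -> measurableTypeR R -> R) x :
  (forall i, pdf (g i)) -> (0 <= prod_pdf g x)%R.
Proof. by move=> pg; apply: prodr_ge0 => i _; have [_ + _] := pg i; exact. Qed.

Lemma measurable_prod_pdfR n (g : 'I_n -> measurableTypeR R -> R) :
  (forall i, pdf (g i)) -> measurable_fun setT (prod_pdf g).
Proof.
move=> pg; apply: measurable_prod => i _.
have [mg _ _] := pg i.
by apply: (measurableT_comp mg); exact: measurable_tnth.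
Qed.

Lemma measurable_prod_pdf n (g : 'I_n -> measurableTypeR R -> R) :
  (forall i, pdf (g i)) -> measurable_fun setT (fun x => (prod_pdf g x)%:E : \bar R).
Proof. by move=> pg; apply/measurable_EFinP; exact: measurable_prod_pdfR. Qed.

Lemma prod_pdf_cons n (g : 'I_n.+1 -> measurableTypeR R -> R) x (v : vec R n) :
  prod_pdf g (tuple_consp (x, v)) =
  (g ord0 x * prod_pdf (fun i => g (lift ord0 i)) v)%R.
Proof.
rewrite /prod_pdf big_ord_recl; congr (_ * _)%R.
by apply: eq_bigr => i _; rewrite tnthS.
Qed.

Lemma integral_lebesgue_vec0 (f : vec R 0 -> \bar R) :
  measurable_fun setT f -> \int[lebesgue_vec R 0]_x f x = f [tuple].
Proof. by move=> mf; rewrite /= integral_dirac// diracT mul1e. Qed.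

Lemma integral_lebesgue_vecS n (f : vec R n.+1 -> \bar R) :
  measurable_fun setT f -> (forall x, 0 <= f x) ->
  \int[lebesgue_vec R n.+1]_x f x =
  \int[mu]_x \int[lebesgue_vec R n]_v f (tuple_consp (x, v)).
Proof.
move=> mf f0.
transitivity (\int[pushforward (mu \x lebesgue_vec R n) (@tuple_consp _ _ n)]_x f x).
  reflexivity.
rewrite ge0_integral_pushforward//.
- rewrite preimage_setT fubini_tonelli1//; last by move=> x; exact: f0.
  apply: (measurableT_comp mf); exact: measurable_tuple_consp.
- exact: measurable_tuple_consp.
Qed.

Lemma measurable_cons_vec n (f : vec R n.+1 -> \bar R) (x : measurableTypeR R) :
  measurable_fun setT f ->
  measurable_fun setT (fun v : vec R n => f (tuple_consp (x, v))).
Proof.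
move=> mf; apply: (measurableT_comp mf).
by apply: (measurableT_comp (@measurable_tuple_consp _ _ n) (pair1_measurable x)).
Qed.

Lemma integral_prod_pdf n (g : 'I_n -> measurableTypeR R -> R) :
  (forall i, pdf (g i)) -> \int[lebesgue_vec R n]_x (prod_pdf g x)%:E = 1.
Proof.
elim: n g => [|n ih] g pg.
  by rewrite integral_lebesgue_vec0 /prod_pdf ?big_ord0//; exact: measurable_prod_pdf.
rewrite integral_lebesgue_vecS.
- have [mg g0 g1] := pg ord0.
  rewrite -[RHS]g1; apply: eq_integral => x _.
  under eq_integral do rewrite prod_pdf_cons EFinM.
  rewrite ge0_integralZl_EFin//; first by rewrite ih ?mule1.
  + by move=> v _; rewrite lee_fin prod_pdf_ge0.
  + exact: measurable_prod_pdf.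
- exact: measurable_prod_pdf.
- by move=> x; rewrite lee_fin prod_pdf_ge0.
Qed.

(** The coordinates on which f does not depend integrate out to 1 whatever their
    density is, so these densities can be exchanged freely. *)
Lemma integral_prod_pdf_marginal n (P : pred 'I_n)
    (g g' : 'I_n -> measurableTypeR R -> R) (f : vec R n -> \bar R) :
  (forall i, pdf (g i)) -> (forall i, pdf (g' i)) ->
  (forall i, P i -> g i = g' i) ->
  measurable_fun setT f -> (forall x, 0 <= f x) ->
  (forall x y, (forall i, P i -> tnth x i = tnth y i) -> f x = f y) ->
  \int[lebesgue_vec R n]_x (f x * (prod_pdf g x)%:E) =
  \int[lebesgue_vec R n]_x (f x * (prod_pdf g' x)%:E).
Proof.
elim: n P g g' f => [|n ih] P g g' f pg pg' gg' mf f0 fP.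
  by apply: eq_integral => x _; rewrite /prod_pdf !big_ord0.
have mfg (h : 'I_n.+1 -> measurableTypeR R -> R) : (forall i, pdf (h i)) ->
    measurable_fun setT (fun x => f x * (prod_pdf h x)%:E).
  by move=> ph; apply: emeasurable_funM => //; exact: measurable_prod_pdf.
have fg0 (h : 'I_n.+1 -> measurableTypeR R -> R) : (forall i, pdf (h i)) ->
    forall x, 0 <= f x * (prod_pdf h x)%:E.
  by move=> ph x; rewrite mule_ge0// lee_fin prod_pdf_ge0.
pose F (h : 'I_n.+1 -> measurableTypeR R -> R) x := \int[lebesgue_vec R n]_v
  (f (tuple_consp (x, v)) * (prod_pdf (fun i => h (lift ord0 i)) v)%:E).
have FE (h : 'I_n.+1 -> measurableTypeR R -> R) : (forall i, pdf (h i)) ->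
    \int[lebesgue_vec R n.+1]_x (f x * (prod_pdf h x)%:E) =
    \int[mu]_x ((h ord0 x)%:E * F h x).
  move=> ph; rewrite integral_lebesgue_vecS//; [|exact: mfg|exact: fg0].
  apply: eq_integral => x _; rewrite /F -ge0_integralZl_EFin//.
  - by apply: eq_integral => v _; rewrite prod_pdf_cons EFinM muleCA.
  - by move=> v _; rewrite mule_ge0// lee_fin prod_pdf_ge0.
  - apply: emeasurable_funM; first exact: measurable_cons_vec.
    exact: measurable_prod_pdf.
  - by have [_ + _] := ph ord0; exact.
have FF x : F g x = F g' x.
  apply: (ih (fun i => P (lift ord0 i))) => //.
  - by move=> i Pi; rewrite gg'.
  - exact: measurable_cons_vec.
  - move=> v w vw; apply: fP => i; case: (unliftP ord0 i) => [j ->|->] // Pj.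
    by rewrite !tnthS; exact: vw.
rewrite (FE _ pg); apply: esym; rewrite (FE _ pg'); apply: esym.
under eq_integral do rewrite FF.
have [P0|P0] := boolP (P ord0).
  by apply: eq_integral => x _; rewrite gg'.
have Fcst x : F g' x = F g' 0%R.
  apply: eq_integral => v _; congr (_ * _); apply: fP => i.
  by case: (unliftP ord0 i) => [j ->|->] Pj; [rewrite !tnthS|rewrite Pj in P0].
have F0 : 0 <= F g' 0%R.
  by apply: integral_ge0 => v _; rewrite mule_ge0// lee_fin prod_pdf_ge0.
under eq_integral do rewrite Fcst; under [RHS]eq_integral do rewrite Fcst.
have [mg g0 g1] := pg ord0; have [mg' g'0 g'1] := pg' ord0.
rewrite !ge0_integralZr//; first by rewrite g1 g'1.
- exact/measurable_EFinP.
- by move=> x _; rewrite lee_fin.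
- exact/measurable_EFinP.
- by move=> x _; rewrite lee_fin.
Qed.

Definition std_pdf n : vec R n -> R := prod_pdf (fun=> normal_pdf 0 1).

Lemma std_pdf_ge0 n x : (0 <= @std_pdf n x)%R.
Proof. by apply: prod_pdf_ge0 => i; exact: pdf_normal. Qed.

Lemma measurable_std_pdf n : measurable_fun setT (fun x => (@std_pdf n x)%:E : \bar R).
Proof. by apply: measurable_prod_pdf => i; exact: pdf_normal. Qed.

Lemma measurable_sum_tnth n (P : pred 'I_n) (a : R) :
  measurable_fun setT (fun x : vec R n => (a + \sum_(i < n | P i) (tnth x i : R))%R).
Proof.
apply: measurable_funD => //.
under eq_fun do rewrite -big_filter.
by apply: measurable_sum => i; exact: measurable_tnth.
Qed.

(** The shift a is what makes the induction on the dimension go through: it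
    absorbs the coordinate that is split off. *)
Lemma integral_std_pdf_sqr n (P : pred 'I_n) (a : R) :
  \int[lebesgue_vec R n]_x
     ((a + \sum_(i < n | P i) (tnth x i : R)) ^+ 2 * std_pdf x)%:E =
  (a ^+ 2 + #|P|%:R)%:E.
Proof.
have mS m (Q : pred 'I_m) b : measurable_fun setT (fun x : vec R m =>
    ((b + \sum_(i < m | Q i) (tnth x i : R)) ^+ 2 * std_pdf x)%:E : \bar R).
  apply/measurable_EFinP; apply: measurable_funM.
    by apply: measurable_funX; exact: measurable_sum_tnth.
  by apply: measurable_prod_pdfR => i; exact: pdf_normal.
have S0 m (Q : pred 'I_m) b (x : vec R m) :
    0 <= ((b + \sum_(i < m | Q i) (tnth x i : R)) ^+ 2 * std_pdf x)%:E.
  by rewrite lee_fin mulr_ge0 ?sqr_ge0 ?std_pdf_ge0.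
elim: n P a => [|n ih] P a.
  rewrite integral_lebesgue_vec0// /std_pdf /prod_pdf !big_ord0 mulr1 addr0.
  by rewrite eq_card0 ?addr0// => -[].
rewrite integral_lebesgue_vecS//.
pose e : R := (P ord0)%:R.
set Q := fun i : 'I_n => P (lift ord0 i).
have cardP : #|P| = (P ord0 + #|Q|)%N.
  rewrite -!sum1_card !big_mkcond/= big_ord_recl.
  congr addn; last by rewrite [RHS]big_mkcond.
transitivity (\int[mu]_x ((normal_pdf 0 1 x)%:E * ((a + e * x) ^+ 2 + #|Q|%:R)%:E)).
  apply: eq_integral => x _; rewrite -ih -ge0_integralZl_EFin//.
  - apply: eq_integral => v _; rewrite -EFinM /std_pdf prod_pdf_cons mulrCA.
    congr (_ * (_ ^+ 2 * _))%:E.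
    rewrite !big_mkcond/= big_ord_recl -/(Q _) addrA; congr (_ + _ + _)%R.
      by rewrite /e; case: (P ord0); rewrite ?mul1r ?mul0r.
    by rewrite [RHS]big_mkcond; apply: eq_bigr => i _; rewrite tnthS.
  - exact: mS.
  - exact: normal_pdf_ge0.
under eq_integral do rewrite -EFinM.
have sqr_ge0' (b x : R) : 0 <= (normal_pdf 0 1 x * (b + x) ^+ 2)%:E.
  by rewrite lee_fin mulr_ge0 ?normal_pdf_ge0 ?sqr_ge0.
have msqr (b : R) : measurable_fun setT
    (fun x : measurableTypeR R => (normal_pdf 0 1 x * (b + x) ^+ 2)%:E : \bar R).
  apply/measurable_EFinP; apply: measurable_funM; first exact: measurable_normal_pdf.
  by apply: measurable_funX; exact: measurable_funD.
have mphi (b : R) : measurable_fun setT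
    (fun x : measurableTypeR R => (b%:E * (normal_pdf 0 1 x)%:E) : \bar R).
  by apply: emeasurable_funM => //; apply/measurable_EFinP; exact: measurable_normal_pdf.
have phiZ (b : R) : (0 <= b)%R -> \int[mu]_x (b%:E * (normal_pdf 0 1 x)%:E) = b%:E.
  move=> b0; rewrite ge0_integralZl_EFin// ?integral_normal_pdf ?mule1//.
  - by move=> x _; rewrite lee_fin normal_pdf_ge0.
  - by apply/measurable_EFinP; exact: measurable_normal_pdf.
rewrite cardP natrD /e; case: (P ord0) => /=.
  under eq_integral do rewrite mul1r mulrDr EFinD [in X in _ + X]mulrC [in X in _ + X]EFinM.
  rewrite ge0_integralD//.
  - by rewrite integral_normal_sqrD phiZ// -EFinD addrA.
  - by move=> x _; rewrite -EFinM lee_fin mulr_ge0 ?normal_pdf_ge0.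
under eq_integral do rewrite mul0r addr0 mulrC EFinM.
by rewrite phiZ ?add0r// addr_ge0 ?sqr_ge0.
Qed.

End product_density.
(** * The density of the correlated Gaussian vector *)
Section correlation.
Context {R : realType}.
Variables (rho : R) (n : nat).
Hypothesis rho01 : 0 < rho < 1.
Implicit Type S : {set 'I_n}.

Definition odds : R := rho / (1 - rho).

(** Coefficient of the squared sum in the quadratic form of the inverse
    covariance matrix with s contaminated coordinates. *)
Definition sqr_coef (s : nat) : R := odds * (1 + odds) / (1 + s%:R * odds).

Definition quad_sq S (x : vec R n) : R :=
  odds / 2 * \sum_(i in S) (tnth x i : R) ^+ 2.

Definition quad_sum S (x : vec R n) : R :=
  sqr_coef #|S| / 2 * (\sum_(i in S) (tnth x i : R)) ^+ 2.

Definition log_ratio S x := quad_sum S x - quad_sq S x.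

(** The inverse square root of the determinant
    (1 - rho)^|S| (1 + |S| odds) of the covariance matrix. *)
Definition ratio_norm S : R :=
  (Num.sqrt (1 + #|S|%:R * odds))^-1 * (Num.sqrt (1 - rho)) ^- #|S|.

Definition corr_pdf S x := ratio_norm S * std_pdf x * expR (log_ratio S x).

Let rho0 : 0 < rho. Proof. by case/andP: rho01. Qed.
Let rho1 : 0 < 1 - rho. Proof. by rewrite subr_gt0; case/andP: rho01. Qed.

Lemma odds_gt0 : 0 < odds. Proof. exact: divr_gt0. Qed.

Let den_gt0 (s : nat) : 0 < 1 + s%:R * odds.
Proof. by rewrite ltr_pwDl// mulr_ge0// ltW// odds_gt0. Qed.

Lemma sqr_coef_ge0 s : 0 <= sqr_coef s.
Proof.
have o0 := odds_gt0.
by apply: divr_ge0; [rewrite mulr_ge0 ?addr_ge0 ?ltW//|exact: ltW].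
Qed.

(** Hadamard's inequality for this matrix; multiplying by (1 - rho) once more
    compensates one more odds, as in Bernoulli's inequality. *)
Lemma ratio_norm_ge1 S : 1 <= ratio_norm S.
Proof.
have o0 := odds_gt0.
rewrite /ratio_norm -invfM invf_ge1; last first.
  by rewrite mulr_gt0 ?exprn_gt0 ?sqrtr_gt0.
have : forall s : nat, (1 + s%:R * odds) * (1 - rho) ^+ s <= 1.
  elim=> [|s ih]; first by rewrite mul0r addr0 mul1r.
  apply: le_trans ih; rewrite exprS mulrA ler_wpM2r ?exprn_ge0//; first exact: ltW.
  rewrite -natr1.
  have rE : odds * (1 - rho) = rho by rewrite /odds divfK// gt_eqF.
  have -> : (1 + (s%:R + 1) * odds) * (1 - rho) =
    1 + s%:R * odds - s%:R * rho * odds + (odds * (1 - rho) - rho) by ring.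
  by rewrite rE subrr addr0 gerBl -mulrA mulr_ge0// mulr_ge0 ?ltW.
move=> /(_ #|S|) h.
rewrite -(@ler_pXn2r _ 2) ?nnegrE ?mulr_ge0 ?exprn_ge0 ?sqrtr_ge0//.
by rewrite expr1n exprMn sqr_sqrtr ?(ltW (den_gt0 _))// -exprM mulnC exprM
  sqr_sqrtr ?(ltW rho1).
Qed.

Let ind S i : R := (i \in S)%:R.

Let corr_inv S : 'M[R]_n :=
  \matrix_(i, j) ((i == j)%:R * (1 + odds * ind S i) - sqr_coef #|S| * ind S i * ind S j).

Let sum_delta (i : 'I_n) (F : 'I_n -> R) : \sum_l (i == l)%:R * F l = F i.
Proof.
rewrite (bigD1 i)//= eqxx mul1r big1 ?addr0// => l li.
by rewrite eq_sym (negbTE li) mul0r.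
Qed.

Let sum_ind S : \sum_l ind S l = #|S|%:R.
Proof.
by rewrite -natr_sum -sum1_card [in RHS]big_mkcond; congr _%:R.
Qed.

(** The Sherman-Morrison formula: the covariance matrix is a diagonal matrix plus
    rho times the square of the indicator vector of S. *)
Lemma correlation_mx_inv S : invmx (correlation_mx rho S) = corr_inv S.
Proof.
have d0 : 1 - rho != 0 by rewrite gt_eqF.
have den0 : 1 - rho + #|S|%:R * rho != 0.
  by rewrite gt_eqF// ltr_pwDl// mulr_ge0// ltW.
have indM i : ind S i * ind S i = ind S i by rewrite /ind; case: (i \in S); rewrite ?mulr1 ?mulr0.
suff C1 : correlation_mx rho S *m corr_inv S = 1%:M.
  have [U _] := mulmx1_unit C1.
  by rewrite -[LHS]mulmx1 -C1 mulmxA mulVmx// mul1mx.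
apply/matrixP => i j; rewrite !mxE.
transitivity (\sum_l ((i == l)%:R * ((1 - rho * ind S i) * corr_inv S l j) +
    rho * ind S i * (ind S l * corr_inv S l j))).
  apply: eq_bigr => l _; rewrite mxE.
  case: eqVneq => [<-|_] /=.
    by rewrite !mul1r (mulrA (rho * _)) -(mulrA rho) indM -mulrDl subrK mul1r.
  rewrite mul0r add0r mulrA; congr (_ * _); rewrite /ind.
  by case: (i \in S); case: (l \in S); rewrite /= ?mulr1 ?mulr0.
rewrite big_split/= sum_delta -big_distrr/=.
have -> : \sum_l ind S l * corr_inv S l j =
    ind S j * (1 + odds) - sqr_coef #|S| * #|S|%:R * ind S j.
  rewrite -sum_ind big_distrr/= big_distrl/=.
  rewrite (eq_bigr (fun l => (j == l)%:R * (ind S l * (1 + odds * ind S l)) -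
      sqr_coef #|S| * ind S l * ind S j)).
    rewrite big_split/= sum_delta sumrN; congr (_ - _).
    by rewrite !mulrDr !mulr1 mulrCA indM mulrC.
  move=> l _; rewrite mxE mulrBr mulrCA (eq_sym l j); congr (_ - _).
  transitivity (sqr_coef #|S| * (ind S l * ind S l) * ind S j); first by ring.
  by rewrite indM.
rewrite mxE; case: eqVneq => [<-|ij] /=.
  rewrite /ind /sqr_coef /odds; case: (i \in S); rewrite /= ?mulr1 ?mulr0 ?mul0r.
    by field; rewrite d0 den0.
  by ring.
rewrite /ind /sqr_coef /odds; case: (i \in S); case: (j \in S); rewrite /= ?mulr1 ?mulr0 ?mul0r.
- by field; rewrite d0 den0.
- by ring.
- by ring.
- by ring.
Qed.

Lemma quad_form_corr S (x : vec R n) :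
  ((vec_col x)^T *m invmx (correlation_mx rho S) *m vec_col x) 0 0 =
  \sum_i (tnth x i : R) ^+ 2 - 2 * log_ratio S x.
Proof.
rewrite correlation_mx_inv mxE.
under eq_bigr do rewrite mxE.
transitivity (\sum_j ((tnth x j : R) ^+ 2 + odds * (ind S j * (tnth x j : R) ^+ 2) -
   sqr_coef #|S| * (\sum_i ind S i * (tnth x i : R)) * (ind S j * (tnth x j : R)))).
  apply: eq_bigr => j _; rewrite !mxE.
  under eq_bigr do rewrite !mxE.
  rewrite (eq_bigr (fun l => (j == l)%:R * ((tnth x l : R) * (1 + odds * ind S l)) -
    sqr_coef #|S| * (ind S l * tnth x l) * ind S j)).
    rewrite big_split/= sum_delta sumrN -big_distrl/= -big_distrr/=; ring.
  by move=> l _; rewrite (eq_sym l j); ring.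
rewrite !big_split/= sumrN -!big_distrr/= /log_ratio /quad_sum /quad_sq.
have indE (F : 'I_n -> R) : \sum_i ind S i * F i = \sum_(i in S) F i.
  by rewrite [RHS]big_mkcond; apply: eq_bigr => i _; rewrite /ind; case: (i \in S);
     rewrite ?mul1r ?mul0r.
by rewrite !indE; field.
Qed.

Lemma std_pdfE (x : vec R n) :
  std_pdf x = normal_peak 1 ^+ n * expR (- (\sum_i (tnth x i : R) ^+ 2) / 2).
Proof.
rewrite /std_pdf /prod_pdf; under eq_bigr do rewrite normal_pdfE ?oner_neq0//.
rewrite big_split/= prodr_const card_ord; congr (_ * _).
rewrite /normal_fun -expR_sum; congr expR.
rewrite -sumrN big_distrl/=; apply: eq_bigr => i _.
by rewrite subr0 expr1n.
Qed.

Lemma gaussian_fun_corr S x : gaussian_fun (correlation_mx rho S) x =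
  (normal_peak 1 ^+ n * ratio_norm S)^-1 * corr_pdf S x.
Proof.
have p0 : normal_peak 1 ^+ n != 0 :> R.
  by rewrite gt_eqF// exprn_gt0// normal_peak_gt0// oner_neq0.
have z0 : ratio_norm S != 0 by rewrite gt_eqF// (lt_le_trans ltr01)// ratio_norm_ge1.
rewrite /gaussian_fun quad_form_corr /corr_pdf std_pdfE.
have -> : - (\sum_i (tnth x i : R) ^+ 2 - 2 * log_ratio S x) / 2 =
   - (\sum_i (tnth x i : R) ^+ 2) / 2 + log_ratio S x by field.
rewrite expRD; field.
by rewrite p0 z0.
Qed.

End correlation.
Section gaussian_mixture.
Local Open Scope ereal_scope.
Context {R : realType}.
Variables (rho : R) (n : nat).
Hypothesis rho01 : (0 < rho < 1)%R.
Implicit Type S : {set 'I_n}.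
Local Notation mu := (@lebesgue_measure R).

Let rho0 : (0 < rho)%R. Proof. by case/andP: rho01. Qed.
Let rho1 : (0 < 1 - rho)%R. Proof. by rewrite subr_gt0; case/andP: rho01. Qed.
Let odds0 : (0 < odds rho)%R. Proof. exact: odds_gt0. Qed.

(** Conditionally on a common factor w, the coordinates are independent: those in
    S are distributed as sqrt rho w + sqrt (1 - rho) Z, the others as Z, with Z
    standard normal. *)
Definition latent_pdf S (w : R) (i : 'I_n) : measurableTypeR R -> R :=
  if i \in S then normal_pdf (Num.sqrt rho * w) (Num.sqrt (1 - rho))
  else normal_pdf 0 1.

Lemma pdf_latent S w i : pdf (latent_pdf S w i).
Proof. by rewrite /latent_pdf; case: ifP => _; exact: pdf_normal. Qed.

Lemma normal_peakV (s : R) : (0 < s)%R -> normal_peak s = (s^-1 * normal_peak 1)%R.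
Proof.
move=> s0; rewrite /normal_peak -mulrnAr sqrtrM ?sqr_ge0// sqrtr_sqr.
by rewrite ger0_norm ?ltW// invfM expr1n mul1r.
Qed.

Lemma latent_pdfE S w i x : i \in S -> latent_pdf S w i x =
  ((Num.sqrt (1 - rho))^-1 * normal_pdf 0 1 x *
   expR (- (odds rho / 2) * x ^+ 2 +
         (Num.sqrt rho * (1 + odds rho) * w) * x - odds rho / 2 * w ^+ 2))%R.
Proof.
move=> iS; rewrite /latent_pdf iS.
have s0 : (0 < Num.sqrt (1 - rho))%R by rewrite sqrtr_gt0.
rewrite !normal_pdfE ?gt_eqF//= normal_peakV// -!mulrA; congr (_ * (_ * _))%R.
rewrite /normal_fun -expRD; congr expR.
rewrite sqr_sqrtr ?(ltW rho1)//.
have sr : (Num.sqrt rho * Num.sqrt rho = rho)%R by rewrite -expr2 sqr_sqrtr// ltW.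
set t := Num.sqrt rho in sr *.
rewrite /odds -sr.
have r1 : (1 - t * t != 0)%R by rewrite sr gt_eqF.
by field.
Qed.

Lemma prod_latent_pdf S w (x : vec R n) :
  prod_pdf (latent_pdf S w) x = ((Num.sqrt (1 - rho)) ^- #|S| * std_pdf x *
    expR (- quad_sq rho S x + Num.sqrt rho * (1 + odds rho) * w *
          (\sum_(i in S) (tnth x i : R)) - odds rho / 2 * w ^+ 2 * #|S|%:R))%R.
Proof.
rewrite /prod_pdf /std_pdf /prod_pdf.
rewrite (eq_bigr (fun i => (if i \in S then (Num.sqrt (1 - rho))^-1 else 1) *
   (normal_pdf 0 1 (tnth x i) * expR (if i \in S then - (odds rho / 2) * (tnth x i : R) ^+ 2 +
         (Num.sqrt rho * (1 + odds rho) * w) * tnth x i - odds rho / 2 * w ^+ 2 else 0)))%R).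
  rewrite big_split/= -big_mkcond/= prodr_const exprVn -[RHS]mulrA; congr (_ * _)%R.
  rewrite big_split/=; congr (_ * _)%R; rewrite -expR_sum -big_mkcond/=; congr expR.
  rewrite !big_split/= sumrN sumr_const -!big_distrr/=.
  by rewrite mulr_natr /quad_sq mulNr.
move=> i _; case: ifPn => iS; first by rewrite latent_pdfE// -[LHS]mulrA.
by rewrite /latent_pdf (negbTE iS) expR0 mul1r mulr1.
Qed.

(** For fixed x the integrand is, by completing the square, a normal density in w
    with mean B / A and variance 1 / A. *)
Lemma corr_pdf_mixture S (x : vec R n) :
  \int[mu]_w ((normal_pdf 0 1 w)%:E * (prod_pdf (latent_pdf S w) x)%:E) =
  (corr_pdf rho S x)%:E.
Proof.
set s := #|S|; set X := (\sum_(i in S) (tnth x i : R))%R.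
have A0 : (0 < 1 + s%:R * odds rho)%R.
  by rewrite ltr_pwDl// mulr_ge0// ltW.
set A := (1 + s%:R * odds rho)%R in A0.
have sA0 : (0 < Num.sqrt A)%R by rewrite sqrtr_gt0.
have sAn : (Num.sqrt A != 0)%R by rewrite gt_eqF.
have sAV : (0 < (Num.sqrt A)^-1)%R by rewrite invr_gt0.
set B := (Num.sqrt rho * (1 + odds rho) * X)%R.
transitivity (\int[mu]_w ((corr_pdf rho S x)%:E * (normal_pdf (B / A) (Num.sqrt A)^-1 w)%:E)).
  apply: eq_integral => w _; rewrite -!EFinM prod_latent_pdf; congr EFin.
  rewrite !normal_pdfE ?gt_eqF//= /corr_pdf /ratio_norm -/s -/A.
  rewrite (normal_peakV sAV) invrK /normal_fun.
  set E1 := expR (- (w - 0) ^+ 2 / _); set E2 := expR (- quad_sq rho S x + _ - _).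
  set E3 := expR (log_ratio _ _ _); set E4 := expR (- (w - B / A) ^+ 2 / _).
  have -> : (normal_peak 1 * E1 * (Num.sqrt (1 - rho) ^- s * std_pdf x * E2) =
    normal_peak 1 * Num.sqrt (1 - rho) ^- s * std_pdf x * (E1 * E2))%R by ring.
  have -> : ((Num.sqrt A)^-1 * Num.sqrt (1 - rho) ^- s * std_pdf x * E3 *
      (Num.sqrt A * normal_peak 1 * E4) =
    normal_peak 1 * Num.sqrt (1 - rho) ^- s * std_pdf x * (E3 * E4))%R.
    by rewrite -[RHS]mul1r -(mulVf sAn); ring.
  congr (_ * _)%R; rewrite /E1 /E2 /E3 /E4 -!expRD; congr expR.
  rewrite /log_ratio /quad_sum -/s -/X /sqr_coef -/A exprVn sqr_sqrtr ?ltW//.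
  rewrite subr0 expr1n.
  have oE : (odds rho * (1 + odds rho) = (Num.sqrt rho * (1 + odds rho)) ^+ 2)%R.
    rewrite exprMn sqr_sqrtr ?ltW// expr2 mulrA; congr (_ * _)%R.
    by rewrite /odds; field; rewrite gt_eqF.
  have sE : (s%:R = (A - 1) / odds rho)%R.
    by rewrite /A (addrC 1%R) addrK mulfK// gt_eqF.
  rewrite oE sE /B; set c := (Num.sqrt rho * _)%R; set q := quad_sq _ _ _.
  have An : (A != 0)%R by rewrite gt_eqF.
  have on : (odds rho != 0)%R by rewrite gt_eqF.
  clearbody c q A X; set o := odds rho in on *; clearbody o; field.
  by rewrite An on.
rewrite ge0_integralZl_EFin//.
- by rewrite integral_normal_pdf mule1.
- by move=> w _; rewrite lee_fin normal_pdf_ge0.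
- by apply/measurable_EFinP; exact: measurable_normal_pdf.
- rewrite /corr_pdf mulr_ge0 ?expR_ge0// mulr_ge0 ?std_pdf_ge0//.
  by rewrite (le_trans ler01)// ratio_norm_ge1.
Qed.

End gaussian_mixture.
(** * One observation *)
Section gaussian_law.
Local Open Scope ereal_scope.
Context {R : realType}.
Variables (rho : R) (n : nat).
Hypothesis rho01 : (0 < rho < 1)%R.
Implicit Types (S A : {set 'I_n}) (f : vec R n -> \bar R).
Local Notation mu := (@lebesgue_measure R).
Local Notation lv := (lebesgue_vec R n).

Lemma corr_pdf_ge0 S x : (0 <= corr_pdf rho S x)%R.
Proof.
rewrite /corr_pdf mulr_ge0 ?expR_ge0// mulr_ge0 ?std_pdf_ge0//.
by rewrite (le_trans ler01)// ratio_norm_ge1.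
Qed.

Lemma measurable_quad_sq S : measurable_fun setT (@quad_sq R rho n S).
Proof.
apply: measurable_funM => //; under eq_fun do rewrite -big_filter.
by apply: measurable_sum => i; apply: measurable_funX; exact: measurable_tnth.
Qed.

Lemma measurable_quad_sum S : measurable_fun setT (@quad_sum R rho n S).
Proof.
apply: measurable_funM => //; apply: measurable_funX.
under eq_fun do rewrite -big_filter.
by apply: measurable_sum => i; exact: measurable_tnth.
Qed.

Lemma measurable_log_ratio S : measurable_fun setT (@log_ratio R rho n S).
Proof.
by apply: measurable_funB; [exact: measurable_quad_sum|exact: measurable_quad_sq].
Qed.

Lemma measurable_corr_pdf S : measurable_fun setT (@corr_pdf R rho n S).
Proof.
apply: measurable_funM.
  apply: measurable_funM => //.
  by apply: measurable_prod_pdfR => i; exact: pdf_normal.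
by apply: measurableT_comp => //; exact: measurable_log_ratio.
Qed.

Let measurable_joint S : measurable_fun setT
  (fun z : measurableTypeR R * vec R n => prod_pdf (latent_pdf rho S z.1) z.2).
Proof.
apply: measurable_prod => i _; rewrite /latent_pdf.
have mi : measurable_fun setT (fun z : measurableTypeR R * vec R n => (tnth z.2 i : R)).
  exact: (measurableT_comp (measurable_tnth i) measurable_snd).
case: (i \in S); last first.
  by apply: (measurableT_comp (measurable_normal_pdf 0 1) mi).
have -> : (fun z : measurableTypeR R * vec R n =>
    normal_pdf (Num.sqrt rho * z.1) (Num.sqrt (1 - rho)) (tnth z.2 i)) =
  (fun z => normal_pdf 0 (Num.sqrt (1 - rho)) (tnth z.2 i - Num.sqrt rho * z.1)%R).
  apply/funext => z; rewrite /normal_pdf; case: eqP => [|_]; last first.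
    by rewrite /normal_fun subr0.
  have /andP[_ ?] := rho01.
  by move/eqP; rewrite gt_eqF// sqrtr_gt0 subr_gt0.
apply: (measurableT_comp (measurable_normal_pdf 0 (Num.sqrt (1 - rho)))).
apply: measurable_funB => //; apply: measurable_funM => //.
Qed.

(** Reduces every question on marginals of the correlated law to product
    densities, w by w. *)
Lemma integral_corr_pdf_mixture S f :
  measurable_fun setT f -> (forall x, 0 <= f x) ->
  \int[lv]_x (f x * (corr_pdf rho S x)%:E) =
  \int[mu]_w ((normal_pdf 0 1 w)%:E *
     \int[lv]_x (f x * (prod_pdf (latent_pdf rho S w) x)%:E)).
Proof.
move=> mf f0.
have phi0 w : 0 <= (normal_pdf (0 : R) 1 w)%:E by rewrite lee_fin normal_pdf_ge0.
have mphi : measurable_fun setT (fun w => (normal_pdf (0 : R) 1 w)%:E : \bar R).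
  by apply/measurable_EFinP; exact: measurable_normal_pdf.
have lat0 w x : 0 <= (prod_pdf (latent_pdf rho S w) x)%:E.
  by rewrite lee_fin prod_pdf_ge0// => i; exact: pdf_latent.
pose F (z : measurableTypeR R * vec R n) := (normal_pdf 0 1 z.1)%:E *
  (f z.2 * (prod_pdf (latent_pdf rho S z.1) z.2)%:E).
have F0 z : 0 <= F z by rewrite !mule_ge0.
have mF : measurable_fun setT F.
  apply: emeasurable_funM; first exact: (measurableT_comp mphi measurable_fst).
  apply: emeasurable_funM; first exact: (measurableT_comp mf measurable_snd).
  by apply/measurable_EFinP; exact: measurable_joint.
have := fubini_tonelli (m1 := mu) (m2 := lv) F mF F0.
rewrite /F /= => FT.
transitivity (\int[lv]_y \int[mu]_x ((normal_pdf 0 1 x)%:E *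
      (f y * (prod_pdf (latent_pdf rho S x) y)%:E))).
  apply: eq_integral => x _.
  rewrite -corr_pdf_mixture//.
  transitivity (\int[mu]_w (f x * ((normal_pdf 0 1 w)%:E *
     (prod_pdf (latent_pdf rho S w) x)%:E))).
    rewrite ge0_integralZl//.
    - apply: emeasurable_funM => //; apply/measurable_EFinP.
      exact: (measurableT_comp (measurable_joint S) (pair2_measurable x)).
    - by move=> w _; rewrite mule_ge0.
  by apply: eq_integral => w _; rewrite muleCA.
rewrite -FT; apply: eq_integral => w _.
rewrite ge0_integralZl_EFin//.
- by move=> x _; rewrite mule_ge0.
- apply: emeasurable_funM => //.
  by apply: measurable_prod_pdf => i; exact: pdf_latent.
- exact: normal_pdf_ge0.
Qed.

Lemma integral_corr_pdf S : \int[lv]_x (corr_pdf rho S x)%:E = 1.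
Proof.
have := @integral_corr_pdf_mixture S (cst 1) (measurable_cst _) (fun=> lee01).
under eq_integral do rewrite mul1e.
move=> ->; rewrite -[RHS](integral_normal_pdf (0 : R) 1).
apply: eq_integral => w _; under eq_integral do rewrite mul1e.
by rewrite integral_prod_pdf ?mule1// => i; exact: pdf_latent.
Qed.

(** The law is a normalized weight, and corr_pdf is proportional to the weight
    function with total mass 1, so the normalizing constant takes care of
    itself. *)
Lemma ge0_integral_gaussian S f :
  measurable_fun setT f -> (forall x, 0 <= f x) ->
  \int[gaussian (correlation_mx rho S)]_x f x =
  \int[lv]_x (f x * (corr_pdf rho S x)%:E).
Proof.
move=> mf f0; apply: (@daniell_measure_unique R _ _
  (gaussian (correlation_mx rho S))
  (fun g => \int[lv]_x (g x * (corr_pdf rho S x)%:E))) => //.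
- apply: (@daniell_integral R _ _ _ _ lv
    (fun x g => g x * (corr_pdf rho S x)%:E)) => [x|g mg g0].
    exact: (daniell_weighted_eval id x (corr_pdf_ge0 S x)).
  by apply: emeasurable_funM => //; apply/measurable_EFinP; exact: measurable_corr_pdf.
move=> B mB.
set c := (normal_peak 1 ^+ n * ratio_norm rho S)^-1%R.
have c0 : (0 < c)%R.
  rewrite invr_gt0 mulr_gt0 ?exprn_gt0 ?normal_peak_gt0 ?oner_neq0//.
  by rewrite (lt_le_trans ltr01)// ratio_norm_ge1.
have weightE D : measurable D -> gaussian_weight (correlation_mx rho S) D =
    c%:E * \int[lv]_(x in D) (corr_pdf rho S x)%:E.
  move=> mD; rewrite -ge0_integralZl_EFin//; last 3 first.
  - by move=> x _; rewrite lee_fin corr_pdf_ge0.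
  - by apply/measurable_EFinP/measurable_funTS; exact: measurable_corr_pdf.
  - exact: ltW.
  by apply: eq_integral => x _; rewrite -EFinM -gaussian_fun_corr.
have weightT : gaussian_weight (correlation_mx rho S) setT = c%:E.
  by rewrite weightE// integral_corr_pdf mule1.
apply: esym; transitivity (
    gaussian_weight (correlation_mx rho S) B *
    (fine (gaussian_weight (correlation_mx rho S) setT))^-1%:E).
  rewrite -[LHS]/(mnormalize (gaussian_weight (correlation_mx rho S))
    \d_([tuple of nseq n 0%R] : vec R n) B).
  by rewrite /mnormalize [X in (X == 0) || (X == +oo)]weightT eqe gt_eqF.
rewrite weightT weightE//= muleAC -EFinM divff ?gt_eqF// mul1e.
rewrite [LHS]integral_mkcond; apply: eq_integral => x _.
by rewrite patchE indicE; case: (x \in B); rewrite ?mul1e ?mul0e.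
Qed.

(** Conditionally on the common factor, only the densities of the coordinates
    outside A change. *)
Lemma integral_gaussian_restrict S A f :
  measurable_fun setT f -> (forall x, 0 <= f x) ->
  (forall x y, (forall i, i \in A -> tnth x i = tnth y i) -> f x = f y) ->
  \int[gaussian (correlation_mx rho S)]_x f x =
  \int[gaussian (correlation_mx rho (S :&: A)%SET)]_x f x.
Proof.
move=> mf f0 fA; rewrite [LHS](ge0_integral_gaussian S mf f0).
rewrite [RHS](ge0_integral_gaussian (S :&: A)%SET mf f0).
rewrite [LHS](integral_corr_pdf_mixture S mf f0).
rewrite [RHS](integral_corr_pdf_mixture (S :&: A)%SET mf f0).
apply: eq_integral => w _; congr (_ * _).
apply: (@integral_prod_pdf_marginal R n (mem A)); try assumption.
- by move=> i; exact: pdf_latent.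
- by move=> i; exact: pdf_latent.
- by move=> i /= iA; rewrite /latent_pdf finset.in_setI iA andbT.
Qed.

Lemma log_ratio0 (x : vec R n) : log_ratio rho (@finset.set0 _) x = 0%R.
Proof.
by rewrite /log_ratio /quad_sum /quad_sq !big_set0 expr0n !mulr0 subrr.
Qed.

Lemma corr_pdf0 (x : vec R n) : corr_pdf rho (@finset.set0 _) x = std_pdf x.
Proof.
rewrite /corr_pdf log_ratio0 expR0 mulr1 /ratio_norm cards0 mul0r addr0 sqrtr1.
by rewrite expr0 invr1 !mul1r.
Qed.

Lemma ge0_integral_gaussian0 f :
  measurable_fun setT f -> (forall x, 0 <= f x) ->
  \int[gaussian (correlation_mx rho (@finset.set0 _))]_x f x =
  \int[lv]_x (f x * (std_pdf x)%:E).
Proof.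
move=> mf f0; rewrite ge0_integral_gaussian//.
by apply: eq_integral => x _; rewrite corr_pdf0.
Qed.

(** Dropping ratio_norm keeps a one-sided inequality, which is enough for lower
    bounds on error probabilities and frees the rest of the argument from
    determinants. *)
Lemma gaussian_dominates S f : measurable_fun setT f -> (forall x, 0 <= f x) ->
  \int[gaussian (correlation_mx rho (@finset.set0 _))]_x
     (f x * (expR (log_ratio rho S x))%:E) <=
  \int[gaussian (correlation_mx rho S)]_x f x.
Proof.
move=> mf f0.
have me : measurable_fun setT (fun x => (expR (log_ratio rho S x))%:E).
  apply/measurable_EFinP/measurableT_comp => //; exact: measurable_log_ratio.
have ms := @measurable_std_pdf R n.
have mc : measurable_fun setT (fun x => (corr_pdf rho S x)%:E).
  by apply/measurable_EFinP; exact: measurable_corr_pdf.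
have fe0 x : 0 <= f x * (expR (log_ratio rho S x))%:E.
  by rewrite mule_ge0// lee_fin expR_ge0.
rewrite [leLHS](ge0_integral_gaussian0 (emeasurable_funM mf me) fe0).
rewrite [leRHS](ge0_integral_gaussian S mf f0).
apply: ge0_le_integral => //.
- by move=> x _; rewrite !mule_ge0// lee_fin ?expR_ge0 ?std_pdf_ge0.
- by do 2! apply: emeasurable_funM => //.
- exact: emeasurable_funM.
move=> x _; rewrite -muleA lee_wpmul2l// -EFinM lee_fin /corr_pdf mulrC.
by rewrite ler_wpM2r ?expR_ge0// ler_peMl ?std_pdf_ge0// ratio_norm_ge1.
Qed.

Let integral_sqr_sum S : \int[lv]_x
    ((\sum_(i in S) (tnth x i : R)) ^+ 2 * std_pdf x)%:E = (#|S|%:R)%:E.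
Proof.
have <- : (0 ^+ 2 + #|mem S|%:R)%:E = (#|S|%:R)%:E :> \bar R by rewrite expr0n add0r.
rewrite -(@integral_std_pdf_sqr R n (mem S) 0).
by apply: eq_integral => x _; rewrite add0r.
Qed.

Let measurable_sqr_sum S : measurable_fun setT
  (fun x : vec R n => ((\sum_(i in S) (tnth x i : R)) ^+ 2 * std_pdf x)%:E).
Proof.
apply/measurable_EFinP; apply: measurable_funM.
  apply: measurable_funX; under eq_fun do rewrite -big_filter.
  by apply: measurable_sum => i; exact: measurable_tnth.
by apply: measurable_prod_pdfR => i; exact: pdf_normal.
Qed.

Lemma integral_quad_sum S :
  \int[gaussian (correlation_mx rho (@finset.set0 _))]_x (quad_sum rho S x)%:E =
  (sqr_coef rho #|S| / 2 * #|S|%:R)%:E.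
Proof.
have c0 : (0 <= sqr_coef rho #|S| / 2)%R by rewrite divr_ge0// sqr_coef_ge0.
rewrite ge0_integral_gaussian0; last 2 first.
- by apply/measurable_EFinP; exact: measurable_quad_sum.
- by move=> x; rewrite lee_fin mulr_ge0 ?sqr_ge0.
rewrite [RHS]EFinM -integral_sqr_sum -ge0_integralZl_EFin; last 4 first.
- exact: measurableT.
- by move=> x _; rewrite lee_fin mulr_ge0 ?sqr_ge0 ?std_pdf_ge0.
- exact: measurable_sqr_sum.
- exact: c0.
by apply: eq_integral => x _; rewrite -!EFinM mulrA.
Qed.

Lemma integral_quad_sq S :
  \int[gaussian (correlation_mx rho (@finset.set0 _))]_x (quad_sq rho S x)%:E =
  (odds rho / 2 * #|S|%:R)%:E.
Proof.
have c0 : (0 <= odds rho / 2)%R by rewrite divr_ge0// ltW// odds_gt0.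
rewrite ge0_integral_gaussian0; last 2 first.
- by apply/measurable_EFinP; exact: measurable_quad_sq.
- by move=> x; rewrite lee_fin mulr_ge0 ?sumr_ge0// => i _; rewrite sqr_ge0.
transitivity (\int[lv]_x \sum_(i in S) (odds rho / 2)%:E *
    ((\sum_(j in [set i]%SET) (tnth x j : R)) ^+ 2 * std_pdf x)%:E).
  apply: eq_integral => x _; under [RHS]eq_bigr do rewrite -EFinM big_set1.
  rewrite sumEFin -EFinM; congr EFin; rewrite /quad_sq big_distrr/= big_distrl/=.
  by apply: eq_bigr => i _; rewrite -[LHS]mulrA.
under eq_integral do rewrite -big_filter.
rewrite ge0_integral_sum; last 3 first.
- exact: measurableT.
- by move=> i; apply: emeasurable_funM => //; exact: measurable_sqr_sum.
- move=> i x _; rewrite mule_ge0 ?lee_fin// mulr_ge0 ?sqr_ge0 ?std_pdf_ge0//.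
rewrite big_filter (eq_bigr (fun=> (odds rho / 2)%:E)).
  by rewrite sumEFin sumr_const mulr_natr.
move=> i _; rewrite ge0_integralZl_EFin; last 4 first.
- exact: measurableT.
- by move=> x _; rewrite lee_fin mulr_ge0 ?sqr_ge0 ?std_pdf_ge0.
- exact: measurable_sqr_sum.
- exact: c0.
by rewrite integral_sqr_sum cards1 mule1.
Qed.

(** The cancellation at first order that makes the loss quadratic in rho. *)
Lemma sqr_coef_gap s : (odds rho - sqr_coef rho s <= odds rho ^+ 2 * s%:R)%R.
Proof.
have o0 := odds_gt0 rho01.
rewrite /sqr_coef; set o := odds rho in o0 *; clearbody o.
have d0 : (0 < 1 + s%:R * o)%R by rewrite ltr_pwDl// mulr_ge0// ltW.
rewrite lerBlDr -lerBlDl.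
rewrite ler_pdivlMr//.
have s0 : (0 <= s%:R :> R)%R by [].
have : (0 <= s%:R * o * o)%R by rewrite !mulr_ge0// ltW.
have : (0 <= s%:R * s%:R * o * o * o)%R by rewrite !mulr_ge0// ltW.
nra.
Qed.

Lemma integral_quad_sq_le S :
  \int[gaussian (correlation_mx rho (@finset.set0 _))]_x (quad_sq rho S x)%:E <=
  \int[gaussian (correlation_mx rho (@finset.set0 _))]_x
    (quad_sum rho S x + odds rho ^+ 2 / 2 * #|S|%:R * #|S|%:R)%:E.
Proof.
under [leRHS]eq_integral do rewrite EFinD.
have c0 : (0 <= sqr_coef rho #|S| / 2)%R by rewrite divr_ge0// sqr_coef_ge0.
rewrite ge0_integralD; last 5 first.
- exact: measurableT.
- by move=> x _; rewrite lee_fin mulr_ge0 ?sqr_ge0.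
- by apply/measurable_EFinP; exact: measurable_quad_sum.
- by move=> x _; rewrite lee_fin mulr_ge0// mulr_ge0// divr_ge0// sqr_ge0.
- by [].
rewrite integral_quad_sq integral_quad_sum integral_cst//= probability_setT mule1.
rewrite -EFinD lee_fin -mulrDl ler_wpM2r//.
have := sqr_coef_gap #|S|; lra.
Qed.

End gaussian_law.
(** * Integration along a history *)
Section history_integral.
Local Open Scope ereal_scope.
Context {R : realType} {n : nat}.
Local Notation vecn := (vec R n).

Lemma measurable_fun_finset d (T : measurableType d) (g : {set 'I_n} -> T) :
  measurable_fun setT g.
Proof. by []. Qed.

(** There are finitely many queries, so measurability in the pair follows from
    measurability in the second component alone. *)
Lemma measurable_observation (F : {set 'I_n} -> vecn -> R) :
  (forall A, measurable_fun setT (F A)) ->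
  measurable_fun setT (fun o : observation R n => F o.1 o.2).
Proof.
move=> mF.
have -> : (fun o : observation R n => F o.1 o.2) =
    (fun o => \sum_(A : {set 'I_n}) (o.1 == A)%:R * F A o.2)%R.
  apply/funext => o; rewrite (bigD1 o.1)//= eqxx mul1r big1 ?addr0// => A oA.
  by rewrite eq_sym (negbTE oA) mul0r.
apply: measurable_sum => A; apply: measurable_funM.
  exact: (measurableT_comp (measurable_fun_finset (fun B => (B == A)%:R : R)) measurable_fst).
exact: (measurableT_comp (mF A) measurable_snd).
Qed.

Lemma measurable_mask (A : {set 'I_n}) : measurable_fun setT (@Defs.mask R n A).
Proof.
apply/measurable_fun_tnthP => i.
rewrite (_ : _ \o _ = fun u : vecn => if i \in A then (tnth u i : R) else 0%R).
  by case: (i \in A) => //; exact: measurable_tnth.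
by apply/funext => u /=; rewrite tnth_mktuple.
Qed.

Lemma measurable_record_round t : measurable_fun setT
  (fun z : (history R n t * {set 'I_n}) * vecn => record_round z.1.1 z.1.2 z.2).
Proof.
apply: measurable_cons; last exact: measurableT_comp.
apply/measurable_fun_pairP; split.
  exact: (measurableT_comp measurable_snd measurable_fst).
apply/measurable_fun_tnthP => i.
pose F (A : {set 'I_n}) (u : vecn) := tnth (Defs.mask A u) i.
rewrite (_ : _ \o _ = (fun o : observation R n => F o.1 o.2) \o
   (fun z : (history R n t * {set 'I_n}) * vecn => (z.1.2, z.2)))//.
apply: measurableT_comp.
  apply: measurable_observation => A.
  exact: (measurableT_comp (measurable_tnth i) (measurable_mask A)).
apply/measurable_fun_pairP; split; last exact: measurable_snd.
exact: (measurableT_comp measurable_snd measurable_fst).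
Qed.

Section next.
Variables (t : nat) (P : probability (history R n t) R).
Variables (q : R.-pker (history R n t) ~> {set 'I_n}).
Variable (N : probability vecn R).

Lemma measurable_integral_round (f : history R n t.+1 -> \bar R) :
  measurable_fun setT f -> (forall h, 0 <= f h) ->
  measurable_fun setT (fun z : history R n t * {set 'I_n} =>
    \int[N]_u f (record_round z.1 z.2 u)).
Proof.
move=> mf f0.
apply: (@measurable_fun_fubini_tonelli_F _ _ _ _ _ N
  (fun z : (history R n t * {set 'I_n}) * vecn =>
     f (record_round z.1.1 z.1.2 z.2))) => //.
exact: (measurableT_comp mf (@measurable_record_round t)).
Qed.

Lemma measurable_integral_query (g : history R n t * {set 'I_n} -> \bar R) :
  measurable_fun setT g -> (forall z, 0 <= g z) ->
  measurable_fun setT (fun h => \int[q h]_A g (h, A)).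
Proof. by move=> mg g0; exact: (measurable_kfcomp q mg g0). Qed.

Lemma ge0_integral_next_law (f : history R n t.+1 -> \bar R) :
  measurable_fun setT f -> (forall h, 0 <= f h) ->
  \int[next_law P q N]_h f h =
  \int[P]_h \int[q h]_A \int[N]_u f (record_round h A u).
Proof.
move=> mf f0; apply: (@daniell_measure_unique R _ _ (next_law P q N)
  (fun g => \int[P]_h \int[q h]_A \int[N]_u g (record_round h A u))); [|move=> B mB|exact: mf|exact: f0].
  apply: (@daniell_integral R _ _ _ _ P
    (fun h g => \int[q h]_A \int[N]_u g (record_round h A u))); last first.
    move=> g mg g0.
    apply: (@measurable_integral_query (fun z => \int[N]_u g (record_round z.1 z.2 u))).
      exact: measurable_integral_round.
    by move=> z; exact: integral_ge0.
  move=> h; apply: (@daniell_integral R _ _ _ _ (q h)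
    (fun A g => \int[N]_u g (record_round h A u))); last first.
    by move=> g mg g0; exact: measurable_fun_finset.
  move=> A; apply: (@daniell_integral R _ _ _ _ N
    (fun u g => g (record_round h A u))); last first.
    move=> g mg g0; apply: (measurableT_comp mg).
    exact: (measurableT_comp (@measurable_record_round t) (pair1_measurable (h, A))).
  move=> u; exact: (@daniell_eval R _ _ _ _ id (record_round h A u)).
apply: eq_integral => h _; apply: eq_integral => A _.
transitivity (\int[N]_u (\1_[set u | B (record_round h A u)] u)%:E).
  by apply: eq_integral => u _.
rewrite (@integral_indic _ _ _ N setT measurableT); first by rewrite setIT.
rewrite -[X in measurable X]setTI.
exact: (measurableT_comp (@measurable_record_round t) (pair1_measurable (h, A))).
Qed.

End next.

(** Log-likelihoods and sample sizes alike are sums over the rounds. *)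
Definition score t (F : {set 'I_n} -> vecn -> R) (h : history R n t) : R :=
  (\sum_(o <- h) F o.1 o.2)%R.

Lemma score_record t F (h : history R n t) A u :
  score F (record_round h A u) = (F A (Defs.mask A u) + score F h)%R.
Proof. by rewrite /score big_cons. Qed.

Lemma measurable_score t (F : {set 'I_n} -> vecn -> R) :
  (forall A, measurable_fun setT (F A)) -> measurable_fun setT (@score t F).
Proof.
move=> mF; rewrite /score; under eq_fun do rewrite big_tuple.
apply: measurable_sum => i.
apply: (measurableT_comp (measurable_observation mF)); exact: measurable_tnth.
Qed.

Lemma score_ge0 t (F : {set 'I_n} -> vecn -> R) (h : history R n t) :
  (forall A x, 0 <= F A x)%R -> (0 <= score F h)%R.
Proof. by move=> F0; apply: sumr_ge0 => o _; exact: F0. Qed.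

End history_integral.
(** * Change of measure along an adaptive strategy *)
Section change_of_measure.
Local Open Scope ereal_scope.
Context {R : realType} {n : nat}.
Variable rho : R.
Hypothesis rho01 : (0 < rho < 1)%R.
Variable strat : strategy R n.
Local Notation null := (@finset.set0 'I_n).
Local Notation N S := (gaussian (correlation_mx rho S)).
Local Notation law S t := (history_law rho S strat t).

Lemma eq_sum_mask S (A : {set 'I_n}) (u : vec R n) (F : R -> R) :
  (\sum_(i in (S :&: A)%SET) F (tnth (Defs.mask A u) i) =
   \sum_(i in (S :&: A)%SET) F (tnth u i))%R.
Proof.
by apply: eq_bigr => i; rewrite finset.in_setI => /andP[_ iA]; rewrite tnth_mktuple iA.
Qed.

Lemma quad_sq_mask S A (u : vec R n) :
  quad_sq rho (S :&: A)%SET (Defs.mask A u) = quad_sq rho (S :&: A)%SET u.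
Proof. by rewrite /quad_sq (eq_sum_mask _ _ _ (fun y => y ^+ 2)%R). Qed.

Lemma quad_sum_mask S A (u : vec R n) :
  quad_sum rho (S :&: A)%SET (Defs.mask A u) = quad_sum rho (S :&: A)%SET u.
Proof. by rewrite /quad_sum (eq_sum_mask _ _ _ id). Qed.

(** The likelihood ratio can be evaluated at the masked vector, that is, by the
    experimenter, since it involves the queried coordinates only. *)
Lemma gaussian_mask_dominates S A (f : vec R n -> \bar R) :
  measurable_fun setT f -> (forall x, 0 <= f x) ->
  \int[N null]_u (f (Defs.mask A u) *
     (expR (log_ratio rho (S :&: A)%SET (Defs.mask A u)))%:E) <=
  \int[N S]_u f (Defs.mask A u).
Proof.
move=> mf f0.
have mfA : measurable_fun setT (fun u => f (Defs.mask A u)).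
  exact: (measurableT_comp mf (measurable_mask A)).
have E : \int[N S]_u f (Defs.mask A u) = \int[N (S :&: A)%SET]_u f (Defs.mask A u).
  apply: (@integral_gaussian_restrict R rho n rho01 S A (f \o Defs.mask A)).
  - exact: mfA.
  - by move=> x; exact: f0.
  move=> x y xy /=; congr (f _); apply: eq_from_tnth => i.
  by rewrite !tnth_mktuple; case: ifPn => // iA; exact: xy.
rewrite [leRHS]E.
have E0 : \int[N null]_u (f (Defs.mask A u) *
     (expR (log_ratio rho (S :&: A)%SET (Defs.mask A u)))%:E) =
   \int[N null]_u ((f \o Defs.mask A) u *
     (expR (log_ratio rho (S :&: A)%SET u))%:E).
  by apply: eq_integral => u _; rewrite /log_ratio quad_sq_mask quad_sum_mask.
rewrite [leLHS]E0; apply: (@gaussian_dominates R rho n rho01 _ (f \o Defs.mask A)).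
  exact: mfA.
by move=> x; exact: f0.
Qed.

Definition log_lik S t : history R n t -> R :=
  @score R n t (fun A => log_ratio rho (S :&: A)%SET).

Lemma measurable_log_lik S t : measurable_fun setT (@log_lik S t).
Proof. by apply: measurable_score => A; exact: measurable_log_ratio. Qed.

(** The query is drawn from the same kernel under both laws, so that the
    likelihood ratio of a history is the product of those of its rounds,
    whatever the strategy is. *)
Lemma history_law_dominates S t (f : history R n t -> \bar R) :
  measurable_fun setT f -> (forall h, 0 <= f h) ->
  \int[law null t]_h (f h * (expR (log_lik S h))%:E) <= \int[law S t]_h f h.
Proof.
elim: t f => [|t ih] f mf f0.
  rewrite /= !integral_dirac//; last first.
    apply: emeasurable_funM => //.
    by apply/measurable_EFinP/measurableT_comp => //; exact: measurable_log_lik.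
  by rewrite diracT !mul1e /log_lik /score big_nil expR0 mule1.
have mL s : measurable_fun setT (fun h : history R n s => (expR (log_lik S h))%:E).
  by apply/measurable_EFinP/measurableT_comp => //; exact: measurable_log_lik.
have L0 s (h : history R n s) : 0 <= (expR (log_lik S h))%:E :> \bar R.
  by rewrite lee_fin expR_ge0.
have mfL : measurable_fun setT (fun h => f h * (expR (log_lik S h))%:E).
  exact: (emeasurable_funM mf (mL _)).
have fL0 h : 0 <= f h * (expR (log_lik S h))%:E by rewrite mule_ge0.
rewrite [leLHS](ge0_integral_next_law (law null t) (strat t) (N null) mfL fL0).
rewrite [leRHS](ge0_integral_next_law (law S t) (strat t) (N S) mf f0).
pose w A u : \bar R := (expR (log_ratio rho (S :&: A)%SET (Defs.mask A u)))%:E.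
have w0 A u : 0 <= w A u by rewrite lee_fin expR_ge0.
(* f' carries the likelihood ratio of the last round only; the induction
   hypothesis, applied to its integral over that round, supplies the others. *)
pose f' (h : history R n t.+1) : \bar R := (f h *
   (let: o := thead h in expR (log_ratio rho (S :&: o.1)%SET o.2))%:E).
have mf' : measurable_fun setT f'.
  apply: emeasurable_funM => //; apply/measurable_EFinP/measurableT_comp => //.
  apply: (measurableT_comp (measurable_observation
     (F := fun A => log_ratio rho (S :&: A)%SET) _)); last exact: measurable_tnth.
  by move=> A; exact: measurable_log_ratio.
have f'0 h : 0 <= f' h by rewrite mule_ge0// lee_fin expR_ge0.
pose G (h : history R n t) := \int[strat t h]_A \int[N null]_u f' (record_round h A u).
have mG1 := measurable_integral_round (N null) mf' f'0.
have mG : measurable_fun setT G.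
  apply: (@measurable_integral_query _ _ _ (strat t) _ mG1) => z.
  by apply: integral_ge0 => u _; exact: f'0.
have G0 h : 0 <= G h.
  by apply: integral_ge0 => A _; apply: integral_ge0 => u _; exact: f'0.
have f'E h A u : f' (record_round h A u) = f (record_round h A u) * w A u.
  by rewrite /f' theadE.
have mrec h A : measurable_fun setT (record_round h A : vec R n -> history R n t.+1).
  exact: (measurableT_comp (@measurable_record_round R n t) (pair1_measurable (h, A))).
have E : \int[law null t]_h \int[strat t h]_A \int[N null]_u
    (f (record_round h A u) * (expR (log_lik S (record_round h A u)))%:E) =
    \int[law null t]_h (G h * (expR (log_lik S h))%:E).
  apply: eq_integral => h _; rewrite /G -ge0_integralZr; last 4 first.
  - exact: measurableT.
  - exact: measurable_fun_finset.
  - by move=> A _; apply: integral_ge0 => u _; exact: f'0.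
  - exact: L0.
  apply: eq_integral => A _; rewrite -ge0_integralZr; last 4 first.
  - exact: measurableT.
  - exact: (measurableT_comp mf' (mrec h A)).
  - by move=> u _; exact: f'0.
  - exact: L0.
  apply: eq_integral => u _; rewrite f'E /log_lik score_record expRD EFinM.
  by rewrite [LHS]muleA.
rewrite [leLHS]E; apply: (le_trans (ih G mG G0)).
have mI S' := measurable_integral_round (N S') mf f0.
apply: ge0_le_integral.
- exact: measurableT.
- by move=> h _; exact: G0.
- exact: mG.
- apply: (@measurable_integral_query _ _ _ (strat t) _ (mI S)) => z.
  by apply: integral_ge0 => u _; exact: f0.
move=> h _; apply: ge0_le_integral.
- exact: measurableT.
- by move=> A _; apply: integral_ge0 => u _; exact: f'0.
- exact: measurable_fun_finset.
- exact: measurable_fun_finset.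
move=> A _.
pose g (x : vec R n) := f [tuple of (A, x) :: h].
have mg : measurable_fun setT g.
  by apply: (measurableT_comp mf); apply: measurable_cons => //; exact: pair1_measurable.
have E' : \int[N null]_u f' (record_round h A u) = \int[N null]_u (g (Defs.mask A u) *
     (expR (log_ratio rho (S :&: A)%SET (Defs.mask A u)))%:E).
  by apply: eq_integral => u _; rewrite f'E.
rewrite [leLHS]E'; apply: gaussian_mask_dominates; first exact: mg.
by move=> x; exact: f0.
Qed.

Lemma integral_score_next t (F : {set 'I_n} -> vec R n -> R) :
  (forall A, measurable_fun setT (F A)) -> (forall A x, (0 <= F A x)%R) ->
  \int[law null t.+1]_h (score F h)%:E =
  \int[law null t]_h \int[strat t h]_A \int[N null]_u (F A (Defs.mask A u))%:E +
  \int[law null t]_h (score F h)%:E.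
Proof.
move=> mF F0.
have ms s : measurable_fun setT (fun h : history R n s => (score F h)%:E).
  by apply/measurable_EFinP; exact: measurable_score.
have s0 s (h : history R n s) : 0 <= (score F h)%:E.
  by rewrite lee_fin score_ge0.
have mFA A : measurable_fun setT (fun u => (F A (Defs.mask A u))%:E).
  by apply/measurable_EFinP; exact: (measurableT_comp (mF A) (measurable_mask A)).
have FA0 A u : 0 <= (F A (Defs.mask A u))%:E by rewrite lee_fin.
rewrite [LHS](ge0_integral_next_law (law null t) (strat t) (N null) (ms _) (s0 _)).
pose G (h : history R n t) := \int[strat t h]_A \int[N null]_u (F A (Defs.mask A u))%:E.
have mG : measurable_fun setT G.
  apply: (@measurable_integral_query _ _ _ (strat t)
    (fun z => \int[N null]_u (F z.2 (Defs.mask z.2 u))%:E)).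
    exact: (measurableT_comp (measurable_fun_finset
      (fun A => \int[N null]_u (F A (Defs.mask A u))%:E)) measurable_snd).
  by move=> z; apply: integral_ge0 => u _; exact: FA0.
have G0 h : 0 <= G h.
  by apply: integral_ge0 => A _; apply: integral_ge0 => u _; exact: FA0.
rewrite -[RHS]ge0_integralD; last 5 first.
- exact: measurableT.
- by move=> h _; exact: G0.
- exact: mG.
- by move=> h _; exact: s0.
- exact: ms.
apply: eq_integral => h _.
transitivity (\int[strat t h]_A
    (\int[N null]_u (F A (Defs.mask A u))%:E + cst (score F h)%:E A)).
  apply: eq_integral => A _.
  transitivity (\int[N null]_u ((F A (Defs.mask A u))%:E + cst (score F h)%:E u)).
    by apply: eq_integral => u _; rewrite score_record.
  rewrite [LHS]ge0_integralD; last 5 first.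
  - exact: measurableT.
  - by move=> u _; exact: FA0.
  - exact: mFA.
  - by move=> u _; exact: s0.
  - exact: measurable_cst.
  congr (_ + _); rewrite integral_cst; last exact: measurableT.
  by rewrite [X in _ * X](probability_setT (N null)) mule1.
rewrite [LHS]ge0_integralD; last 5 first.
- exact: measurableT.
- by move=> A _; apply: integral_ge0 => u _; exact: FA0.
- exact: measurable_fun_finset.
- by move=> A _; exact: s0.
- exact: measurable_cst.
congr (_ + _); rewrite integral_cst; last exact: measurableT.
by rewrite prob_kernel mule1.
Qed.

(** An inequality between expectations of one round with a deterministic query
    transfers to adaptive strategies, as a fresh vector is independent of the
    query. *)
Lemma integral_score_le t (F1 F2 : {set 'I_n} -> vec R n -> R) :
  (forall A, measurable_fun setT (F1 A)) -> (forall A x, (0 <= F1 A x)%R) ->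
  (forall A, measurable_fun setT (F2 A)) -> (forall A x, (0 <= F2 A x)%R) ->
  (forall A, \int[N null]_u (F1 A (Defs.mask A u))%:E <=
             \int[N null]_u (F2 A (Defs.mask A u))%:E) ->
  \int[law null t]_h (score F1 h)%:E <= \int[law null t]_h (score F2 h)%:E.
Proof.
move=> mF1 F10 mF2 F20 F12; elim: t => [|t ih].
  rewrite /= !integral_dirac//.
  - by rewrite /score !big_nil.
  - by apply/measurable_EFinP; exact: measurable_score.
  - by apply/measurable_EFinP; exact: measurable_score.
rewrite [leLHS](integral_score_next t mF1 F10) [leRHS](integral_score_next t mF2 F20).
have m2 (F : {set 'I_n} -> vec R n -> R) : (forall A x, (0 <= F A x)%R) ->
    measurable_fun setT (fun h : history R n t =>
      \int[strat t h]_A \int[N null]_u (F A (Defs.mask A u))%:E).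
  move=> F0; apply: (@measurable_integral_query _ _ _ (strat t)
    (fun z => \int[N null]_u (F z.2 (Defs.mask z.2 u))%:E)).
    exact: (measurableT_comp (measurable_fun_finset
      (fun A => \int[N null]_u (F A (Defs.mask A u))%:E)) measurable_snd).
  by move=> z; apply: integral_ge0 => u _; rewrite lee_fin.
apply: leeD; last exact: ih.
apply: ge0_le_integral.
- exact: measurableT.
- by move=> h _; apply: integral_ge0 => A _; apply: integral_ge0 => u _; rewrite lee_fin.
- exact: m2.
- exact: m2.
move=> h _; apply: ge0_le_integral.
- exact: measurableT.
- by move=> A _; apply: integral_ge0 => u _; rewrite lee_fin.
- exact: measurable_fun_finset.
- exact: measurable_fun_finset.
by move=> A _; exact: F12.
Qed.

End change_of_measure.
(** * Lower bound for two hypotheses *)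

(** For a log-likelihood ratio T, the sum of the two error probabilities has
    density m with respect to the null law: 1 where the test rejects, expR T
    where it accepts.  If T >= - a, both values are
    at least expR (- a), and T <= expR T; otherwise the left side is negative.
    The left side is linear in T and expR T, whose expectations are under
    control. *)
Lemma truncated_likelihood (R : realType) (a T m : R) : 0 < a ->
  m = 1 \/ m = expR T -> expR (- a) * (a + T - expR T) <= a * m.
Proof.
move=> a0 mE; have m0 : 0 < m by case: mE => ->; rewrite ?ltr01 ?expR_gt0.
have [aT|Ta] := leP (- a) T; last first.
  apply: (@le_trans _ _ 0); last by rewrite mulr_ge0// ltW.
  rewrite pmulr_rle0 ?expR_gt0//; have := expR_gt0 T; lra.
have am : expR (- a) <= m.
  by case: mE => ->; rewrite ?ler_expR// -expR0 ler_expR oppr_le0 ltW.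
apply: (@le_trans _ _ (expR (- a) * a)); last by rewrite mulrC ler_wpM2l// ltW.
rewrite ler_wpM2l ?expR_ge0//; have := expR_ge1Dx T; lra.
Qed.

Section two_point.
Local Open Scope ereal_scope.
Context {R : realType} {n : nat}.
Variable rho : R.
Hypothesis rho01 : (0 < rho < 1)%R.
Variable strat : strategy R n.
Local Notation null := (@finset.set0 'I_n).
Local Notation N S := (gaussian (correlation_mx rho S)).
Local Notation law S t := (history_law rho S strat t).
Implicit Type S : {set 'I_n}.

(** A bound for the Kullback-Leibler divergence of one round; the first factor
    |S| is a crude bound for |S :&: A|, which makes the cost linear in the
    overlap. *)
Definition divergence_cost S (A : {set 'I_n}) (x : vec R n) : R :=
  (odds rho ^+ 2 / 2 * #|S|%:R * #|(S :&: A)%SET|%:R)%R.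

Let score_sq S t := @score R n t (fun A => quad_sq rho (S :&: A)%SET).
Let score_sum S t := @score R n t (fun A => quad_sum rho (S :&: A)%SET).
Let score_cost S t := @score R n t (divergence_cost S).

Let quad_sq_ge0 S (x : vec R n) : (0 <= quad_sq rho S x)%R.
Proof.
rewrite mulr_ge0//; first by rewrite divr_ge0// ltW// odds_gt0.
by apply: sumr_ge0 => i _; exact: sqr_ge0.
Qed.

Let quad_sum_ge0 S (x : vec R n) : (0 <= quad_sum rho S x)%R.
Proof. by rewrite mulr_ge0 ?sqr_ge0// divr_ge0// sqr_coef_ge0. Qed.

Let cost_ge0 S A (x : vec R n) : (0 <= divergence_cost S A x)%R.
Proof. by rewrite mulr_ge0// mulr_ge0// divr_ge0// sqr_ge0. Qed.

Let msq S t : measurable_fun setT (@score_sq S t).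
Proof. by apply: measurable_score => A; exact: measurable_quad_sq. Qed.

Let msum S t : measurable_fun setT (@score_sum S t).
Proof. by apply: measurable_score => A; exact: measurable_quad_sum. Qed.

Let mcost S t : measurable_fun setT (@score_cost S t).
Proof. by apply: measurable_score => A; exact: measurable_cst. Qed.

(** Stated as a comparison of nonnegative parts: the expected log-likelihood ratio
    itself is a difference of integrals. *)
Lemma integral_score_sq_le S t :
  \int[law null t]_h (score_sq S h)%:E <=
  \int[law null t]_h (score_sum S h)%:E + \int[law null t]_h (score_cost S h)%:E.
Proof.
rewrite -[leRHS]ge0_integralD; last 5 first.
- exact: measurableT.
- by move=> h _; rewrite lee_fin score_ge0.
- by apply/measurable_EFinP; exact: msum.
- by move=> h _; rewrite lee_fin score_ge0.
- by apply/measurable_EFinP; exact: mcost.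
pose F (A : {set 'I_n}) (x : vec R n) :=
  (quad_sum rho (S :&: A)%SET x + divergence_cost S A x)%R.
have E : \int[law null t]_h ((score_sum S h)%:E + (score_cost S h)%:E) =
    \int[law null t]_h (score F h)%:E.
  by apply: eq_integral => h _; rewrite -EFinD /score_sum /score_cost /score big_split.
rewrite [leRHS]E; apply: integral_score_le.
- by move=> A; exact: measurable_quad_sq.
- by move=> A x; exact: quad_sq_ge0.
- by move=> A; apply: measurable_funD; [exact: measurable_quad_sum|exact: measurable_cst].
- by move=> A x; rewrite addr_ge0.
move=> A; under eq_integral do rewrite quad_sq_mask.
under [leRHS]eq_integral do rewrite /F quad_sum_mask.
apply: (le_trans (integral_quad_sq_le rho01 _)).
apply: ge0_le_integral.
- exact: measurableT.
- move=> u _; rewrite lee_fin addr_ge0//.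
  by rewrite mulr_ge0// mulr_ge0// divr_ge0// sqr_ge0.
- apply/measurable_EFinP; apply: measurable_funD => //; exact: measurable_quad_sum.
- apply/measurable_EFinP; apply: measurable_funD => //; exact: measurable_quad_sum.
move=> u _; rewrite lee_fin lerD2l /divergence_cost ler_wpM2r// ler_wpM2l//.
  by rewrite divr_ge0// sqr_ge0.
by rewrite ler_nat subset_leq_card// finset.subsetIl.
Qed.

(** Needed to cancel this term on both sides of an inequality between extended
    reals. *)
Lemma integral_score_sum_lty S t : \int[law null t]_h (score_sum S h)%:E < +oo.
Proof.
pose c : R := (\sum_(B : {set 'I_n}) sqr_coef rho #|B| / 2 * #|B|%:R)%R.
have c0 B : (0 <= sqr_coef rho #|B| / 2 * #|B|%:R)%R.
  by rewrite mulr_ge0// divr_ge0// sqr_coef_ge0.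
apply: (@le_lt_trans _ _ (\int[law null t]_h (score (fun=> cst c) h)%:E)).
  apply: integral_score_le.
  - by move=> A; exact: measurable_quad_sum.
  - by move=> A x; exact: quad_sum_ge0.
  - by move=> A; exact: measurable_cst.
  - by move=> A x; apply: sumr_ge0.
  move=> A; under eq_integral do rewrite quad_sum_mask.
  rewrite [leLHS](integral_quad_sum rho01).
  have E : \int[N null]_u (cst c (Defs.mask A u))%:E = \int[N null]_u cst c%:E u.
    exact: eq_integral.
  rewrite [leRHS]E integral_cst; last exact: measurableT.
  rewrite [X in _ * X](probability_setT (N null)) mule1 lee_fin.
  rewrite /c (bigD1 (S :&: A)%SET)//= lerDl; apply: sumr_ge0 => B _; exact: c0.
have E : \int[law null t]_h (score (fun=> cst c) h)%:E =
    \int[law null t]_h cst (c *+ t)%:E h.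
  apply: eq_integral => h _; rewrite /score big_tuple /= sumr_const card_ord.
  by [].
rewrite E integral_cst; last exact: measurableT.
by rewrite [X in _ * X](probability_setT (law null t)) mule1 ltry.
Qed.

(** Integrating truncated_likelihood with a = 2 (C + 1) leaves
    expR (- a) (1 - (C + 1) / a), because the expected likelihood ratio is at
    most 1. *)
Lemma two_point_bound S t (phi : {mfun history R n t >-> bool}) (C : R) :
  (0 <= C)%R -> \int[law null t]_h (score_cost S h)%:E <= C%:E ->
  (expR (- (2 * (C + 1))) / 2)%:E <=
  law null t [set h | phi h != false] + law S t [set h | phi h != true].
Proof.
move=> C0 costC.
set a := (2 * (C + 1))%R.
have a0 : (0 < a)%R by rewrite /a mulr_gt0// ltr_wpDl.
set P := law null t.
set B := [set h | phi h != false].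
have mB : measurable B.
  rewrite (_ : B = phi @^-1` [set true]); last first.
    by apply/seteqP; split => h; rewrite /B /=; case: (phi h).
  by rewrite -[X in measurable X]setTI; exact: measurable_funP.
have BC : [set h | phi h != true] = ~` B.
  by apply/seteqP; split => h; rewrite /B /=; case: (phi h).
have mBC : measurable (~` B) by exact: measurableC.
rewrite BC.
pose L (h : history R n t) : R := expR (log_lik rho S h).
have mL : measurable_fun setT (fun h : history R n t => (L h)%:E : \bar R).
  by apply/measurable_EFinP/measurableT_comp => //; exact: measurable_log_lik.
have L0 h : 0 <= (L h)%:E :> \bar R by rewrite lee_fin expR_ge0.
have mi (D : set (history R n t)) : measurable D ->
    measurable_fun setT (fun h => (\1_D h)%:E : \bar R).
  by move=> mD; apply/measurable_EFinP; exact: measurable_indic.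
have i0 (D : set (history R n t)) h : 0 <= (\1_D h)%:E :> \bar R by rewrite lee_fin.
have PSB : \int[P]_h ((\1_(~` B) h)%:E * (L h)%:E) <= law S t (~` B).
  have := history_law_dominates rho01 strat S (mi _ mBC) (i0 (~` B)).
  by rewrite (@integral_indic _ _ _ (law S t) setT measurableT)// setIT.
have intL : \int[P]_h (L h)%:E <= 1.
  have := history_law_dominates rho01 strat S (measurable_cst 1) (fun h : history R n t => lee01).
  rewrite integral_cst; last exact: measurableT.
  rewrite [X in _ * X](probability_setT (law S t)) mule1.
  by under eq_integral do rewrite mul1e.
have PB : P B = \int[P]_h (\1_B h)%:E.
  by rewrite (@integral_indic _ _ _ P setT measurableT)// setIT.
have sq := integral_score_sq_le S t.
have q1e := integral_score_sum_lty S t.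
have q20 : 0 <= \int[P]_h (score_sum S h)%:E.
  by apply: integral_ge0 => h _; rewrite lee_fin score_ge0.
rewrite -/P in sq q1e costC.
have msum' : measurable_fun setT (fun h : history R n t => (score_sum S h)%:E : \bar R).
  by apply/measurable_EFinP; exact: msum.
have msq' : measurable_fun setT (fun h : history R n t => (score_sq S h)%:E : \bar R).
  by apply/measurable_EFinP; exact: msq.
have sum0 h : 0 <= (@score_sum S t h)%:E :> \bar R by rewrite lee_fin score_ge0.
have sq0 h : 0 <= (@score_sq S t h)%:E :> \bar R by rewrite lee_fin score_ge0.
set e := expR (- a).
have e0 : (0 <= e)%R by exact: expR_ge0.
have ea0 : 0 <= (e / a)%:E by rewrite lee_fin divr_ge0// ltW.
have main : e%:E + (e / a)%:E * \int[P]_h (score_sum S h)%:E <=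
   (P B + law S t (~` B)) + (e / a)%:E * (\int[P]_h (score_sq S h)%:E + \int[P]_h (L h)%:E).
  apply: (@le_trans _ _ (P B + \int[P]_h ((\1_(~` B) h)%:E * (L h)%:E) +
      (e / a)%:E * (\int[P]_h (score_sq S h)%:E + \int[P]_h (L h)%:E))); last first.
    by apply: leeD => //; apply: leeD.
  have m1 : measurable_fun setT (fun h : history R n t =>
      (\1_(~` B) h)%:E * (L h)%:E : \bar R) by exact: emeasurable_funM (mi _ mBC) mL.
  have m01 h : 0 <= (\1_(~` B) h)%:E * (L h)%:E :> \bar R by rewrite mule_ge0.
  have intD (f g : history R n t -> \bar R) : measurable_fun setT f ->
      (forall h, 0 <= f h) -> measurable_fun setT g -> (forall h, 0 <= g h) ->
      \int[P]_h f h + \int[P]_h g h = \int[P]_h (f h + g h).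
    by move=> mf f0 mg g0; rewrite ge0_integralD.
  have intZ (f : history R n t -> \bar R) : measurable_fun setT f ->
      (forall h, 0 <= f h) ->
      (e / a)%:E * \int[P]_h f h = \int[P]_h ((e / a)%:E * f h).
    by move=> mf f0; rewrite ge0_integralZl.
  have mZ (f : history R n t -> \bar R) : measurable_fun setT f ->
      measurable_fun setT (fun h => (e / a)%:E * f h).
    by move=> mf; exact: emeasurable_funM (measurable_cst _) mf.
  have Z0 (f : history R n t -> \bar R) : (forall h, 0 <= f h) ->
      forall h, 0 <= (e / a)%:E * f h by move=> f0 h; exact: mule_ge0.
  have D0 (f g : history R n t -> \bar R) : (forall h, 0 <= f h) ->
      (forall h, 0 <= g h) -> forall h, 0 <= f h + g h.
    by move=> f0 g0 h; exact: adde_ge0.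
  have eE : \int[P]_h cst e%:E h = e%:E.
    rewrite integral_cst; last exact: measurableT.
    by rewrite [X in _ * X](probability_setT P) mule1.
  have cste (h : history R n t) : 0 <= cst e%:E h :> \bar R by rewrite lee_fin.
  have mB1 := mi _ mB; have B0 := i0 B.
  have mD1 := emeasurable_funD msq' mL; have D10 := D0 _ _ sq0 L0.
  have mD2 := emeasurable_funD mB1 m1; have D20 := D0 _ _ B0 m01.
  rewrite -eE PB (intZ _ msum' sum0) (intD _ _ msq' sq0 mL L0) (intZ _ mD1 D10).
  rewrite (intD _ _ (measurable_cst _) cste (mZ _ msum') (Z0 _ sum0)).
  rewrite (intD _ _ mB1 B0 m1 m01) (intD _ _ mD2 D20 (mZ _ mD1) (Z0 _ D10)).
  apply: ge0_le_integral.
  - exact: measurableT.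
  - by move=> h _; apply: adde_ge0; [exact: cste|exact: (Z0 _ sum0)].
  - exact: emeasurable_funD (measurable_cst _) (mZ _ msum').
  - exact: emeasurable_funD mD2 (mZ _ mD1).
  move=> h _ /=; rewrite -!(EFinM, EFinD) lee_fin.
  have LE : L h = expR (score_sum S h - score_sq S h).
    by rewrite /L /log_lik /score_sum /score_sq /score /log_ratio sumrB.
  set m := (\1_B h + \1_(~` B) h * L h)%R.
  have mE : m = 1%R \/ m = L h.
    rewrite /m !indicE in_setC; case: (h \in B) => /=.
      by left; rewrite mul0r addr0.
    by right; rewrite add0r mul1r.
  rewrite LE in mE.
  have := truncated_likelihood a0 mE.
  rewrite -LE -/e => key.
  rewrite -subr_ge0 -/m.
  have -> : (m + e / a * (score_sq S h + L h) - (e + e / a * score_sum S h) =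
      (a * m - e * (a + (score_sum S h - score_sq S h) - L h)) / a)%R.
    by field; rewrite gt_eqF.
  by rewrite divr_ge0 ?subr_ge0// ltW.
have [q2 q2E] : exists q2 : R, \int[P]_h (score_sum S h)%:E = q2%:E.
  by exists (fine (\int[P]_h (score_sum S h)%:E)); rewrite fineK// ge0_fin_numE.
rewrite q2E in main sq.
have up : \int[P]_h (score_sq S h)%:E + \int[P]_h (L h)%:E <= (q2 + C + 1)%:E.
  rewrite EFinD; apply: leeD intL; apply: (le_trans sq).
  by rewrite EFinD; apply: leeD.
have {main up} := le_trans main (leeD (lexx _) (lee_wpmul2l ea0 up)).
have [b bE] : exists b : R, P B = b%:E.
  by exists (fine (P B)); rewrite fineK// fin_num_measure.
have [b' b'E] : exists b' : R, law S t (~` B) = b'%:E.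
  by exists (fine (law S t (~` B))); rewrite fineK// fin_num_measure.
rewrite bE b'E -!EFinM -!EFinD !lee_fin => main.
have aC : ((e / a) * (C + 1) = e / 2)%R by rewrite /a; field; rewrite gt_eqF// ltr_wpDl.
have : ((e / a) * (q2 + C + 1) = (e / a) * q2 + (e / a) * (C + 1))%R by ring.
rewrite aC; move: main; lra.
Qed.

End two_point.
(** * A contaminated set that is hardly ever queried *)
Section blocks.
Local Open Scope nat_scope.
Variables n k : nat.
Hypothesis k_gt0 : 0 < k.

Definition block (j : 'I_(n %/ k)) : {set 'I_n} := interval_set n k (j * k).

Lemma block_end (j : 'I_(n %/ k)) : j * k + k <= n.
Proof.
rewrite addnC -mulSn (leq_trans _ (leq_trunc_div n k))//.
by rewrite leq_mul2r ltn_ord orbT.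
Qed.

Lemma card_interval_set z : z + k <= n -> #|interval_set n k z| = k.
Proof.
move=> zk; pose f (i : 'I_k) : 'I_n := widen_ord zk (rshift z i).
have f_inj : injective f by move=> i j /(congr1 val) /= /addnI /val_inj.
rewrite -[RHS](card_ord k) -(card_imset _ f_inj); apply: eq_card => i.
rewrite finset.inE; apply/idP/imsetP => [/andP[zi izk]|[j _ ->] /=].
  have ik : i - z < k by rewrite ltn_subLR.
  by exists (Ordinal ik) => //; apply: val_inj; rewrite /= subnKC.
by rewrite leq_addr ltn_add2l ltn_ord.
Qed.

(** The disjoint intervals belong to every class, which reduces the three cases
    of the theorem to one. *)
Lemma block_in_class c j : block j \in class_of c n k.
Proof.
case: c => /=; first by rewrite finset.inE card_interval_set// block_end.
  have jn : j * k < n by rewrite (leq_trans _ (block_end j))// -[ltnLHS]addn0 ltn_add2l.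
  by apply/imsetP; exists (Ordinal jn) => //; rewrite finset.inE /= block_end.
by apply/imsetP; exists j.
Qed.

(** An index i can only belong to the block of number i %/ k. *)
Lemma sum_card_block (A : {set 'I_n}) :
  \sum_(j < n %/ k) #|(block j :&: A)%SET| <= #|A|.
Proof.
have -> : \sum_(j < n %/ k) #|(block j :&: A)%SET| =
    \sum_(i in A) \sum_(j < n %/ k) (i \in block j).
  rewrite exchange_big; apply: eq_bigr => j _.
  rewrite -sum1_card big_mkcond [RHS]big_mkcond; apply: eq_bigr => i _.
  by rewrite finset.in_setI; case: (i \in block j); case: (i \in A).
rewrite -sum1_card; apply: leq_sum => i _.
rewrite -big_mkcond sum1_card; apply/card_le1_eqP => j j'.
have blockE (l : 'I_(n %/ k)) : i \in block l -> l = i %/ k :> nat.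
  rewrite finset.inE => /andP[li il].
  have -> : i %/ k = (l * k + (i - l * k)) %/ k by rewrite subnKC.
  by rewrite divnMDl// (@divn_small (i - l * k)) ?addn0// ltn_subLR.
move=> /blockE jE /blockE j'E; apply: val_inj.
by rewrite /= jE j'E.
Qed.

End blocks.

Section block_overlap.
Local Open Scope ereal_scope.
Context {R : realType} {n : nat}.
Variable rho : R.
Hypothesis rho01 : (0 < rho < 1)%R.
Variable strat : strategy R n.
Local Notation null := (@finset.set0 'I_n).
Local Notation law t := (history_law rho null strat t).

Definition overlap (S : {set 'I_n}) t (h : history R n t) : R :=
  score (fun A (_ : vec R n) => #|(S :&: A)%SET|%:R) h.

Let overlap_ge0 S t (h : history R n t) : (0 <= overlap S h)%R.
Proof. by apply: score_ge0. Qed.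

Let moverlap S t : measurable_fun setT (fun h : history R n t => (overlap S h)%:E : \bar R).
Proof.
by apply/measurable_EFinP; apply: measurable_score => A; exact: measurable_cst.
Qed.

Lemma integral_queries_le M : AS M strat ->
  \int[law M]_h ((queries h)%:R%:E : \bar R) <= M%:R%:E.
Proof.
move=> ASM.
have mq : measurable_fun setT (fun h : history R n M => ((queries h)%:R : R)).
  have := @measurable_score R n M (fun A _ => #|A|%:R) (fun=> measurable_cst _).
  by congr measurable_fun; apply/funext => h; rewrite /score /queries natr_sum.
have mD : measurable [set h : history R n M | (queries h <= M)%N].
  have := mq measurableT _ (measurable_itv `]-oo, M%:R%R]).
  congr measurable; rewrite setTI; apply/seteqP; split => h /=;
    by rewrite in_itv/= ler_nat.
rewrite -[leRHS]mule1 -(probability_setT (law M)) -integral_cst; last exact: measurableT.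
apply: ae_ge0_le_integral.
- exact: measurableT.
- by move=> h _; rewrite lee_fin.
- exact/measurable_EFinP.
- by move=> h _; rewrite lee_fin.
- exact: measurable_cst.
exists (~` [set h : history R n M | (queries h <= M)%N]); split.
- exact: measurableC.
- by rewrite [LHS](probability_setC (law M) mD) (ASM _ _ rho01) subee.
- move=> h /= /not_implyP[_]; by apply: contra_not => /=; rewrite lee_fin ler_nat.
Qed.

(** Pigeonhole over the blocks, for expectations under the null law. *)
Lemma exists_block_small_overlap k M : (0 < k <= n)%N -> AS M strat ->
  exists j : 'I_(n %/ k),
    \int[law M]_h (overlap (block j) h)%:E <= (M%:R / (n %/ k)%:R)%:E.
Proof.
move=> /andP[k0 kn] ASM.
set J := (n %/ k)%N; have J0 : (0 < J)%N by rewrite divn_gt0.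
have sumM : \sum_(j < J) \int[law M]_h (overlap (block j) h)%:E <= M%:R%:E.
  apply: le_trans (integral_queries_le ASM).
  rewrite -ge0_integral_sum; last 3 first.
  - exact: measurableT.
  - by move=> j; exact: moverlap.
  - by move=> j h _; rewrite lee_fin.
  apply: ge0_le_integral.
  - exact: measurableT.
  - by move=> h _; apply: sume_ge0 => j _; rewrite lee_fin.
  - by apply: emeasurable_sum => j; exact: moverlap.
  - have := @measurable_score R n M (fun A _ => #|A|%:R) (fun=> measurable_cst _).
    move=> /measurable_EFinP; congr measurable_fun; apply/funext => h /=.
    by rewrite /score /queries natr_sum.
  move=> h _; rewrite sumEFin lee_fin /overlap /score /queries exchange_big natr_sum/=.
  by apply: ler_sum => o _; rewrite -natr_sum ler_nat sum_card_block.
apply: contrapT => /forallNP all_big.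
have big (j : 'I_J) : (M%:R / J%:R)%:E < \int[law M]_h (overlap (block j) h)%:E.
  by rewrite ltNge; apply/negP; exact: all_big.
have fin (j : 'I_J) : exists2 r : R, \int[law M]_h (overlap (block j) h)%:E = r%:E & (M%:R / J%:R < r)%R.
  have j0 : 0 <= \int[law M]_h (overlap (block j) h)%:E.
    by apply: integral_ge0 => h _; rewrite lee_fin.
  have jM : \int[law M]_h (overlap (block j) h)%:E <= M%:R%:E.
    apply: le_trans sumM; rewrite (bigD1 j)//= leeDl// sume_ge0// => i _.
    by apply: integral_ge0 => h _; rewrite lee_fin.
  have := big j; case: (\int[law M]_h _) j0 jM => // r _ _ rM.
  by exists r => //; rewrite -lte_fin.
pose r (j : 'I_J) : R := fine (\int[law M]_h (overlap (block j) h)%:E).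
have rE (j : 'I_J) : \int[law M]_h (overlap (block j) h)%:E = (r j)%:E
    /\ (M%:R / J%:R < r j)%R.
  by rewrite /r; have [s -> sM] := fin j.
move: sumM; rewrite (eq_bigr (fun j => (r j)%:E)); last by move=> j _; have [] := rE j.
rewrite sumEFin lee_fin leNgt => /negP; apply.
have -> : M%:R = (\sum_(j < J) M%:R / J%:R)%R :> R.
  by rewrite sumr_const card_ord -[RHS]mulr_natr divfK// pnatr_eq0 -lt0n.
apply: ltr_sum.
  by apply/hasP; exists (Ordinal J0); rewrite ?mem_index_enum.
by move=> j _; have [] := rE j.
Qed.

End block_overlap.
(** * The minimax risk *)
Section minimax.
Local Open Scope ereal_scope.
Context {R : realType}.

(** The constant 4 B^2 bounds the total cost of the block that is hardly queried:
    odds <= 2 rho because rho <= 1/2, and n <= 2 k (n %/ k) because k <= n. *)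
Lemma minimax_risk_ge (c : class_kind) (n k M : nat) (rho B : R) :
  (0 < rho)%R -> (rho <= 2^-1)%R -> (0 < k <= n)%N ->
  (rho * k%:R * Num.sqrt (M%:R / n%:R) <= B)%R ->
  (expR (- (2 * (4 * B ^+ 2 + 1))) / 2)%:E <= minimax_risk rho (class_of c n k) M.
Proof.
move=> rho0 rhoh kn hB; have /andP[k0 k_le_n] := kn.
have rho01 : (0 < rho < 1)%R.
  by rewrite rho0 (le_lt_trans rhoh)// invf_lt1// ltr1n.
apply: le_ereal_inf_tmp => _ [strat [ASM [phi ->]]].
have [j hj] := exists_block_small_overlap rho01 kn ASM.
have C0 : (0 <= 4 * B ^+ 2)%R by rewrite mulr_ge0// sqr_ge0.
have cost : \int[history_law rho (@finset.set0 _) strat M]_h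
    (score (divergence_cost rho (block j)) h)%:E <= (4 * B ^+ 2)%:E.
  set w := (odds rho ^+ 2 / 2 * #|block j|%:R)%R.
  have w0 : (0 <= w)%R by rewrite mulr_ge0// divr_ge0// sqr_ge0.
  have E : \int[history_law rho (@finset.set0 _) strat M]_h
      (score (divergence_cost rho (block j)) h)%:E =
    \int[history_law rho (@finset.set0 _) strat M]_h (w%:E * (overlap (block j) h)%:E).
    apply: eq_integral => h _; rewrite -EFinM; congr EFin.
    by rewrite /overlap /score big_distrr.
  rewrite [leLHS]E ge0_integralZl_EFin; last 4 first.
  - exact: measurableT.
  - by move=> h _; rewrite lee_fin; apply: score_ge0.
  - by apply/measurable_EFinP; apply: measurable_score => A; exact: measurable_cst.
  - exact: w0.
  apply: (le_trans (lee_wpmul2l _ hj)); first by rewrite lee_fin.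
  rewrite -EFinM lee_fin /w card_interval_set ?block_end//.
  have oB : (odds rho <= 2 * rho)%R.
    rewrite /odds ler_pdivrMr ?subr_gt0; last by case/andP: rho01.
    have : (rho * rho <= 2^-1 * rho)%R by rewrite ler_wpM2r// ltW.
    lra.
  have n0 : (0 < n)%N by exact: leq_trans k0 k_le_n.
  have J0 : (0 < n %/ k)%N by rewrite divn_gt0.
  have nJ : (n <= 2 * k * (n %/ k))%N.
    by have := ltn_ceil n k0; move: J0; nia.
  have MJ : (M%:R / (n %/ k)%:R <= 2 * k%:R * (M%:R / n%:R) :> R)%R.
    rewrite mulrCA ler_wpM2l// ler_pdivlMr ?ltr0n// mulrC ler_pdivrMr ?ltr0n//.
    by rewrite -!natrM ler_nat.
  have xB : ((rho * k%:R * Num.sqrt (M%:R / n%:R)) ^+ 2 <= B ^+ 2)%R.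
    by rewrite ler_pXn2r ?nnegrE// ?(le_trans _ hB)// !mulr_ge0 ?sqrtr_ge0// ltW.
  rewrite exprMn sqr_sqrtr ?divr_ge0// in xB.
  have o2 : (odds rho ^+ 2 <= (2 * rho) ^+ 2)%R.
    have o0 := ltW (odds_gt0 rho01).
    by rewrite ler_pXn2r ?nnegrE// mulr_ge0// ltW.
  apply: (@le_trans _ _ ((2 * rho) ^+ 2 / 2 * k%:R * (2 * k%:R * (M%:R / n%:R)))%R).
    apply: ler_pM; last exact: MJ.
    - by rewrite mulr_ge0// divr_ge0// sqr_ge0.
    - by rewrite divr_ge0.
    - by rewrite ler_wpM2r// ler_wpM2r.
  apply: le_trans (ler_wpM2l _ xB) => //.
  rewrite le_eqVlt; apply/orP; left; apply/eqP; field.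
  by rewrite pnatr_eq0 -lt0n.
apply: (le_trans (two_point_bound rho01 phi C0 cost)).
rewrite /risk; apply: leeD => //.
by rewrite (bigD1 (block j)) ?block_in_class//= le_max lexx.
Qed.

End minimax.

Theorem corollary1 (R : realType) (c : class_kind) (k M : nat -> nat)
    (rho : nat -> R)
    (hrho : forall n, 0 < rho n < 1)
    (hM : forall n, (2 <= M n)%N)
    (hk : k n @[n --> \oo] --> \oo)
    (hm : ((M n)%:R / n%:R : R) @[n --> \oo] --> +oo)
    (hkn : (fun n => (k n)%:R : R^o) =o_\oo (fun n => n%:R : R^o))
    (hrhok : (rho : nat -> R^o) =o_\oo (fun n => (k n)%:R^-1 : R^o))
    (hrisk : minimax_risk (rho n) (class_of c n (k n)) (M n) @[n --> \oo]
               --> 0%E) :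
  (rho n * (k n)%:R * Num.sqrt ((M n)%:R / n%:R)) @[n --> \oo] --> +oo.
Proof.
apply/cvgryPge => B.
pose delta : R := expR (- (2 * (4 * B ^+ 2 + 1))) / 2.
have delta0 : 0 < delta by rewrite divr_gt0 ?expR_gt0.
have small_risk : \forall n \near \oo,
    (minimax_risk (rho n) (class_of c n (k n)) (M n) < delta%:E)%E.
  apply: (hrisk [set x | (x < delta%:E)%E]); apply: open_nbhs_nbhs; split.
    exact: open_ereal_lt_ereal.
  by rewrite /= lte_fin.
have k_pos : \forall n \near \oo, (0 < k n)%N.
  exact: (cvgnyPge _).1 hk 1%N.
have k_le : \forall n \near \oo, (k n <= n)%N.
  have /eqoP/(_ _ ltr01) := hkn.
  by apply: filterS => n; rewrite mul1r !ger0_norm// ler_nat.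
have rho_small : \forall n \near \oo, rho n <= 2^-1.
  have half0 : (0 : R) < 2^-1 by rewrite invr_gt0.
  have /eqoP/(_ _ half0) := hrhok.
  apply: filterS => n; rewrite ger0_norm; last by case/andP: (hrho n) => /ltW.
  move/le_trans; apply.
  rewrite ger0_norm ?invr_ge0// ler_piMr ?invr_ge0//.
  by case: (k n) => [|m]; rewrite ?invr0// invf_le1// ler1n.
near=> n.
rewrite leNgt; apply/negP => ltB.
have : (minimax_risk (rho n) (class_of c n (k n)) (M n) < delta%:E)%E by near: n.
apply/negP; rewrite -leNgt; apply: minimax_risk_ge; last exact: ltW.
- by case/andP: (hrho n).
- by near: n.
- by apply/andP; split; near: n.
Unshelve. all: by end_near.
Qed.
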